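(* For $c,d\in\mathcal{G}(\mathbb{R}^n)$ and $f\in\mathcal{G}(\mathbb{R}^{n+1})$, let $u\in\mathcal{G}(\mathbb{R}^{n+1})$ be the solution (which exists and is unique in $\mathcal{G}(\mathbb{R}^{n+1})$) of the Cauchy problem for the linear wave equation $$(\partial_t^2-\Delta)u=f\ \text{ in }\mathcal{G}(\mathbb{R}^{n+1}),\qquad u|_{\{t=0\}}=c,\quad \partial_tu|_{\{t=0\}}=d\ \text{ in }\mathcal{G}(\mathbb{R}^n).$$ Then $u$ depends continuously on $f$, $c$ and $d$; that is, the map $\mathcal{G}(\mathbb{R}^n)\times\mathcal{G}(\mathbb{R}^n)\times\mathcal{G}(\mathbb{R}^{n+1})\to\mathcal{G}(\mathbb{R}^{n+1})$, $(c,d,f)\mapsto u$, is continuous.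
   Context: For $m\ge1$, $\mathcal{G}(\mathbb{R}^m)=\mathcal{E}_M(\mathbb{R}^m)/\mathcal{N}(\mathbb{R}^m)$ is the Colombeau algebra, where $\mathcal{E}_M(\mathbb{R}^m)$ is the set of nets $(u_\varepsilon)_\varepsilon\in C^\infty(\mathbb{R}^m)^{(0,1]}$ such that for all compact $K\subset\mathbb{R}^m$ and $\alpha\in\mathbb{N}^m$ there is $N\in\mathbb{N}$ with $\sup_{K}|\partial^\alpha u_\varepsilon|=O(\varepsilon^{-N})$ as $\varepsilon\to0$, and $\mathcal{N}(\mathbb{R}^m)$ is the set of nets such that $\sup_K|\partial^\alpha u_\varepsilon|=O(\varepsilon^q)$ for all $K$, $\alpha$ and $q\in\mathbb{N}$. Derivatives and restrictions to $\{t=0\}$ are defined on representatives. The (sharp) topology of $\mathcal{G}(\mathbb{R}^m)$ is given by the ultra-pseudo-seminorms $\mathcal{P}_{K,j}(u)=e^{-\mathrm{v}_{K,j}(u)}$, $K\subset\mathbb{R}^m$ compact, $j\in\mathbb{N}$, where $\mathrm{v}_{K,j}(u)=\sup\{b\in\mathbb{R}:\sup_{x\in K,|\alpha|\le j}|\partial^\alpha u_\varepsilon(x)|=O(\varepsilon^b)\text{ as }\varepsilon\to0\}$. Products carry the product topology. Points of $\mathbb{R}^{n+1}$ are written $(x,t)$ with $x\in\mathbb{R}^n$, and $\Delta$ is the Laplacian in $x$. Unique solvability of the Cauchy problem in $\mathcal{G}(\mathbb{R}^{n+1})$ for arbitrary $c,d,f$ is a known fact. *)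

(* Defs.v *)
From HB Require Import structures.
From mathcomp Require Import all_boot all_order all_algebra.
From mathcomp Require Import generic_quotient ring_quotient.
From mathcomp Require Import all_classical all_reals all_analysis.
From mathcomp Require Import complex.

Set Implicit Arguments.
Unset Strict Implicit.
Unset Printing Implicit Defensive.

Import Order.TTheory GRing.Theory Num.Theory.
Import numFieldNormedType.Exports.

Local Open Scope classical_set_scope.
Local Open Scope ring_scope.
Local Open Scope quotient_scope.

Section PartialDerivatives.
Context {R : realType} {m : nat}.
Implicit Types (g : 'rV[R]_m -> R) (i : 'I_m).

Definition pderiv i g : 'rV[R]_m -> R := fun x => 'D_('e_i) g x.

Fixpoint is_Ck (k : nat) g : Prop :=
  continuous g /\
  if k is k'.+1 then
    forall i, (forall x, derivable g x 'e_i) /\ is_Ck k' (pderiv i g)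
  else True.

Definition smooth g : Prop := forall k, is_Ck k g.

(* For alpha = (a_0, ..., a_(m-1)), this is D_0^a_0 ... D_(m-1)^a_(m-1). *)
Definition mderiv (alpha : 'I_m -> nat) g : 'rV[R]_m -> R :=
  foldr (fun i h => iter (alpha i) (pderiv i) h) g (enum 'I_m).

Definition mdegree (alpha : 'I_m -> nat) : nat := (\sum_(i < m) alpha i)%N.

Lemma smooth_cont g : smooth g -> continuous g.
Proof. by move=> /(_ 0%N) []. Qed.

Lemma smooth_derivable g i x : smooth g -> derivable g x 'e_i.
Proof. by move=> /(_ 1%N) [_ /(_ i)[]]. Qed.

Lemma smooth_pderiv g i : smooth g -> smooth (pderiv i g).
Proof. by move=> sg k; have [_ /(_ i)[]] := sg k.+1. Qed.

Lemma pderivB g h i : smooth g -> smooth h ->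
  pderiv i (g - h) = pderiv i g - pderiv i h.
Proof.
move=> sg sh; apply/funext => x; rewrite /pderiv.
by rewrite deriveB//; exact: smooth_derivable.
Qed.

Lemma is_CkB k g h : is_Ck k g -> is_Ck k h -> is_Ck k (g - h).
Proof.
elim: k g h => [|k IH] g h /= [cg dg] [ch dh].
  by split=> // x; apply: continuousB; [exact: cg|exact: ch].
split=> [x|i]; first by apply: continuousB; [exact: cg|exact: ch].
have [[dg1 dg2] [dh1 dh2]] := (dg i, dh i); split.
  by move=> x; exact: derivableB.
suff -> : pderiv i (g - h) = pderiv i g - pderiv i h by exact: IH.
by apply/funext => x; rewrite /pderiv deriveB.
Qed.

Lemma smoothB g h : smooth g -> smooth h -> smooth (g - h).
Proof. by move=> sg sh k; exact: is_CkB. Qed.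

Lemma is_derive_line g (a v : 'rV[R]_m) (t : R) :
  derivable g (a + t *: v) v ->
  is_derive t 1 (fun s : R => g (a + s *: v)) ('D_v g (a + t *: v)).
Proof.
move=> dg; rewrite /derivable in dg.
have E : (fun h : R => h^-1 *: (((fun s : R => g (a + s *: v)) \o shift t) (h *: 1)
     - g (a + t *: v))) =
   (fun h : R => h^-1 *: ((g \o shift (a + t *: v)) (h *: v) - g (a + t *: v))).
  apply/funext => h /=; congr (_ *: (g _ - _)).
  by rewrite [h *: 1]mulr1 scalerDl addrCA.
by split; rewrite ?/derivable ?/derive E.
Qed.

(* The second difference of g equals the mixed derivative at a nearby point. *)
Lemma second_difference g i j x (h : R) : smooth g -> 0 < h ->
  exists a b : R, [/\ 0 <= a <= h, 0 <= b <= h &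
    g (x + h *: 'e_i + h *: 'e_j) - g (x + h *: 'e_i)
      - (g (x + h *: 'e_j) - g x) =
    pderiv j (pderiv i g) (x + a *: 'e_i + b *: 'e_j) * h * h].
Proof.
move=> sg h0.
pose phi (s : R) := g (x + h *: 'e_j + s *: 'e_i) - g (x + s *: 'e_i).
have dphi (s : R) : is_derive s 1 phi
    (pderiv i g (x + h *: 'e_j + s *: 'e_i) - pderiv i g (x + s *: 'e_i)).
  by apply: is_deriveB; apply: is_derive_line; exact: smooth_derivable.
have [|a] := @MVT_segment R phi _ 0 h (ltW h0) (fun s _ => dphi s).
  apply: continuous_subspaceT => s.
  by apply/differentiable_continuous/derivable1_diffP; have [] := dphi s.
rewrite in_itv/= subr0 => ah E1.
pose psi (s : R) := pderiv i g (x + a *: 'e_i + s *: 'e_j).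
have dpsi (s : R) : is_derive s 1 psi
    (pderiv j (pderiv i g) (x + a *: 'e_i + s *: 'e_j)).
  by apply: is_derive_line; apply: smooth_derivable; exact: smooth_pderiv.
have [|b] := @MVT_segment R psi _ 0 h (ltW h0) (fun s _ => dpsi s).
  apply: continuous_subspaceT => s.
  by apply/differentiable_continuous/derivable1_diffP; have [] := dpsi s.
rewrite in_itv/= subr0 => bh E2.
exists a, b; split=> //; rewrite -E2 /psi.
rewrite scale0r addr0 -[x + a *: _ + h *: _]addrA [a *: _ + _]addrC addrA.
rewrite -E1 /phi scale0r !addr0.
rewrite -[x + h *: 'e_i + h *: _]addrA [h *: 'e_i + _]addrC addrA.
by rewrite !opprD !opprK !addrA; rewrite addrAC.
Qed.

Lemma pderivC g i j : smooth g -> pderiv i (pderiv j g) = pderiv j (pderiv i g).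
Proof.
move=> sg; apply/funext => x.
have ne (l : 'I_m) : `|('e_l : 'rV[R]_m)| <= 1.
  rewrite [`|_|]mx_normrE; apply/bigmax_leP; split=> // k _.
  by rewrite mxE normr_nat lern1 leq_b1.
have key (G : 'rV[R]_m -> R) : continuous G -> forall e : R, 0 < e -> exists2 d : R, 0 < d &
    forall a b : R, 0 <= a <= d -> 0 <= b <= d -> forall k l : 'I_m,
    `|G x - G (x + a *: 'e_k + b *: 'e_l)| < e.
  move=> cG e e0; have /cvgrPdist_lt /(_ e e0) := cG x.
  move=> /nbhs_normP[d /= d0 dG]; exists (d / 3); first by rewrite divr_gt0.
  move=> a b /andP[a0 ad] /andP[b0 bd] k l; apply: dG => /=.
  rewrite /ball_ -addrA opprD addrA subrr add0r normrN.
  apply: (le_lt_trans (ler_normD _ _)); rewrite !normrZ !ger0_norm//.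
  apply: (@le_lt_trans _ _ (d / 3 + d / 3)).
    apply: lerD; [apply: le_trans (ler_wpM2l a0 (ne k)) _|
                  apply: le_trans (ler_wpM2l b0 (ne l)) _]; by rewrite mulr1.
  rewrite -mulrDr -[X in _ < X]mulr1 ltr_pM2l// -[3^-1]mul1r -mulrDl.
  by rewrite ltr_pdivrMr// mul1r (_ : 1 + 1 = 2%:R)// ltr_nat.
have cij : continuous (pderiv i (pderiv j g)).
  by apply: smooth_cont; do 2 apply: smooth_pderiv.
have cji : continuous (pderiv j (pderiv i g)).
  by apply: smooth_cont; do 2 apply: smooth_pderiv.
apply/eqP; rewrite -subr_eq0 -normr_le0; apply/ler_addgt0Pl => e e0.
rewrite addr0; have e2 : 0 < e / 2 by rewrite divr_gt0.
have [d1 d10 H1] := key _ cij _ e2; have [d2 d20 H2] := key _ cji _ e2.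
pose h := Num.min d1 d2; have h0 : 0 < h by rewrite lt_min d10.
have [a [b [/andP[a0 ah] /andP[b0 bh] Eab]]] := second_difference i j x sg h0.
have [c [d [/andP[c0 ch] /andP[d0 dh] Ecd]]] := second_difference j i x sg h0.
have Eq : pderiv j (pderiv i g) (x + a *: 'e_i + b *: 'e_j) =
          pderiv i (pderiv j g) (x + c *: 'e_j + d *: 'e_i).
  apply: (mulIf (lt0r_neq0 h0)); apply: (mulIf (lt0r_neq0 h0)).
  apply: etrans (esym Eab) _; apply: etrans _ Ecd.
  rewrite (addrAC x (h *: 'e_j)) !opprB.
  by rewrite [LHS]addrACA [RHS]addrACA [X in _ + X]addrC.
move: ah bh ch dh; rewrite !le_min => /andP[a1 a2] /andP[b1 b2] /andP[c1 c2]
  /andP[d1' d2'].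
have := H2 a b; rewrite a0 a2 b0 b2 => /(_ isT isT i j).
have := H1 c d; rewrite c0 c1 d0 d1' => /(_ isT isT j i).
rewrite Eq => {}H1 {}H2.
have tri (A B C : R) : `|A - C| < e / 2 -> `|B - C| < e / 2 -> `|A - B| <= e.
  rewrite (distrC B) => HA HB; rewrite -(subrKA C).
  by apply: le_trans (ler_normD _ _) _; rewrite [leRHS]splitr lerD ?ltW.
exact: tri H1 H2.
Qed.

Local Notation mds alpha g s :=
  (foldr (fun i h => iter (alpha i) (pderiv i) h) g s).

Let smooth_mds alpha g (s : seq 'I_m) : smooth g -> smooth (mds alpha g s).
Proof.
move=> sg; elim: s => //= i s IH; elim: (alpha i) => //= k.
exact: smooth_pderiv.
Qed.

Lemma smooth_mderiv alpha g : smooth g -> smooth (mderiv alpha g).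
Proof. exact: smooth_mds. Qed.

Let mds_pderiv alpha g i (s : seq 'I_m) : smooth g ->
  mds alpha (pderiv i g) s = pderiv i (mds alpha g s).
Proof.
move=> sg; elim: s => //= j s ->; elim: (alpha j) => //= k ->.
apply: pderivC; elim: k => [|k] /=; first exact: smooth_mds.
exact: smooth_pderiv.
Qed.

Definition mincr i (alpha : 'I_m -> nat) : 'I_m -> nat :=
  fun j => (alpha j + (j == i))%N.

Lemma mderiv_pderiv alpha g i : smooth g ->
  mderiv alpha (pderiv i g) = mderiv (mincr i alpha) g.
Proof.
move=> sg; rewrite /mderiv mds_pderiv//.
suff H : forall s : seq 'I_m, uniq s -> mds (mincr i alpha) g s =
    if i \in s then pderiv i (mds alpha g s) else mds alpha g s.
  by rewrite H ?enum_uniq// mem_enum.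
elim=> //= j s IH /andP[js /IH ->]; rewrite inE /mincr eq_sym.
have [->|ij] := eqVneq i j; last first.
  rewrite /= addn0; case: ifP => // _.
  elim: (alpha j) => //= k ->; apply: pderivC.
  by elim: k => [|k] /=; [exact: smooth_mds|exact: smooth_pderiv].
by rewrite (negbTE js) addn1.
Qed.

Lemma mderivB alpha g h : smooth g -> smooth h ->
  mderiv alpha (g - h) = mderiv alpha g - mderiv alpha h.
Proof.
move=> sg sh; rewrite /mderiv; elim: (enum _) => //= i s ->.
elim: (alpha i) => //= k ->; apply: pderivB; elim: k => [|k] /=;
  by [exact: smooth_mds|exact: smooth_pderiv].
Qed.

Lemma pderiv0 i : pderiv i 0 = 0.
Proof. by apply/funext => x; exact: derive_cst. Qed.

Lemma smooth0 : smooth 0.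
Proof.
elim=> [|k IH] /=; split=> //; try exact: cst_continuous.
by move=> i; split=> [x|]; [exact: derivable_cst|rewrite pderiv0].
Qed.

Lemma mderiv0 alpha : mderiv alpha 0 = 0.
Proof.
rewrite /mderiv; elim: (enum _) => //= i s ->.
by elim: (alpha i) => //= k ->; rewrite pderiv0.
Qed.

End PartialDerivatives.

Section RestrictionReal.
Context {R : realType} {n : nat}.
Implicit Types g : 'rV[R]_(n + 1) -> R.

Definition embed0 (x : 'rV[R]_n) : 'rV[R]_(n + 1) := row_mx x 0.

Lemma embed0_continuous : continuous embed0.
Proof.
move=> x; apply/(@cvgrPdist_lt _ _ _ (nbhs x)) => e e0.
rewrite -nbhs_ballE; exists e => //= y; rewrite -ball_normE.
rewrite /ball_/= /embed0 opp_row_mx add_row_mx subr0 => xy.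
rewrite [`|_|]mx_normrE; apply/bigmax_ltP; split=> // -[a b] _ /=.
rewrite mxE; case: (fintype.split b) => c; last by rewrite mxE normr0.
apply: le_lt_trans xy; rewrite [leRHS]mx_normrE.
exact: (le_bigmax _ (fun p : 'I_1 * 'I_n => `|(x - y) p.1 p.2|) (a, c)).
Qed.

Lemma embed0_line (x : 'rV[R]_n) (h : R) i :
  embed0 (h *: 'e_i + x) = h *: 'e_(lshift 1 i) + embed0 x.
Proof.
apply/rowP => j; rewrite !mxE; case: splitP => k jk; rewrite !mxE !eqxx /=.
  by congr (h * (nat_of_bool _)%:R + _); rewrite -!val_eqE /= jk.
by rewrite -!val_eqE /= jk gtn_eqF ?mulr0 ?addr0// ltn_addr.
Qed.

Lemma pderiv_embed0 g i :
  pderiv i (g \o embed0) = pderiv (lshift 1 i) g \o embed0.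
Proof.
apply/funext => x; rewrite /pderiv /derive /=.
by under eq_fun do rewrite embed0_line.
Qed.

Lemma smooth_embed0 g : smooth g -> smooth (g \o embed0).
Proof.
move=> sg k; have {sg} := sg k; elim: k g => [|k IH] g [cg dg].
  by split=> // x; apply: continuous_comp; [exact: embed0_continuous|exact: cg].
split=> [x|i].
  by apply: continuous_comp; [exact: embed0_continuous|exact: cg].
have [dgi /IH] := dg (lshift 1 i); rewrite -pderiv_embed0 => Ck; split=> // x.
have := dgi (embed0 x); rewrite /derivable /=.
by under [in X in X -> _]eq_fun do rewrite -embed0_line.
Qed.

Definition mlift (alpha : 'I_n -> nat) : 'I_(n + 1) -> nat :=
  fun j => if fintype.split j is inl i then alpha i else 0%N.

Lemma mderiv_embed0 alpha g :
  mderiv alpha (g \o embed0) = mderiv (mlift alpha) g \o embed0.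
Proof.
have E : enum 'I_(n + 1) = map (lshift 1) (enum 'I_n) ++ map (@rshift n 1) (enum 'I_1).
  apply: (inj_map (@ord_inj _)); rewrite map_cat val_enum_ord.
  rewrite -[in X in _ ++ X]map_comp -[in X in X ++ _]map_comp.
  rewrite iotaD; congr (_ ++ _); first by rewrite -val_enum_ord; exact: eq_map.
  by rewrite enum_ordSl enum_ord0 /= addn0.
rewrite /mderiv E foldr_cat.
have -> : foldr (fun i h => iter (mlift alpha i) (pderiv i) h) g
    (map (@rshift n 1) (enum 'I_1)) = g.
  elim: (enum 'I_1) => //= j s ->; rewrite /mlift.
  by case: splitP => // k /= jk; have := ltn_ord k; rewrite -jk ltnNge leq_addr.
elim: (enum 'I_n) => //= i s ->; rewrite /mlift.
case: splitP => k /= ik; last first.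
  by have := ltn_ord i; rewrite ik ltnNge leq_addr.
have -> : k = i by exact/ord_inj.
by elim: (alpha i) => //= l ->; rewrite pderiv_embed0.
Qed.

End RestrictionReal.

Section ComplexFunctions.
Context {R : realType} {m : nat}.
Implicit Types f : 'rV[R]_m -> R[i].

Definition Repart {V : Type} (f : V -> R[i]) : V -> R := fun x => complex.Re (f x).
Definition Impart {V : Type} (f : V -> R[i]) : V -> R := fun x => complex.Im (f x).

(* Real-linear operators act on complex-valued functions componentwise. *)
Definition cmap {V W : Type} (F : (V -> R) -> W -> R) (f : V -> R[i]) :
    W -> R[i] :=
  fun x => (F (Repart f) x +i* F (Impart f) x)%C.

Definition csmooth f : Prop :=
  smooth (Repart f) /\ smooth (Impart f).

Definition cpderiv (i : 'I_m) : ('rV[R]_m -> R[i]) -> 'rV[R]_m -> R[i] :=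
  cmap (pderiv i).

Definition cmderiv (alpha : 'I_m -> nat) :
    ('rV[R]_m -> R[i]) -> 'rV[R]_m -> R[i] :=
  cmap (mderiv alpha).

Lemma csmooth0 : csmooth 0.
Proof. by split; exact: smooth0. Qed.

Lemma RepartB f g : Repart (f - g) = Repart f - Repart g.
Proof. by apply/funext => x; rewrite /Repart !fctE; case: (f x) (g x) => [a b] []. Qed.

Lemma ImpartB f g : Impart (f - g) = Impart f - Impart g.
Proof. by apply/funext => x; rewrite /Impart !fctE; case: (f x) (g x) => [a b] []. Qed.

Lemma csmoothB f g : csmooth f -> csmooth g -> csmooth (f - g).
Proof. by move=> [? ?] [? ?]; split; rewrite ?RepartB ?ImpartB; exact: smoothB. Qed.

Lemma csmooth_cpderiv i f : csmooth f -> csmooth (cpderiv i f).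
Proof. by move=> [? ?]; split; exact: smooth_pderiv. Qed.

Lemma cpderivB i f g : csmooth f -> csmooth g ->
  cpderiv i (f - g) = cpderiv i f - cpderiv i g.
Proof.
move=> [? ?] [? ?]; apply/funext => x.
by rewrite /cpderiv /cmap RepartB ImpartB !pderivB.
Qed.

Lemma cmderivB alpha f g : csmooth f -> csmooth g ->
  cmderiv alpha (f - g) = cmderiv alpha f - cmderiv alpha g.
Proof.
move=> [? ?] [? ?]; apply/funext => x.
by rewrite /cmderiv /cmap RepartB ImpartB !mderivB.
Qed.

Lemma cmderiv_cpderiv alpha i f : csmooth f ->
  cmderiv alpha (cpderiv i f) = cmderiv (mincr i alpha) f.
Proof.
move=> [? ?]; apply/funext => x; rewrite /cmderiv /cmap.
by congr (_ +i* _)%C; rewrite -mderiv_pderiv.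
Qed.

Lemma cmderiv0 alpha : cmderiv alpha 0 = 0.
Proof.
by apply/funext => x; rewrite /cmderiv /cmap; congr (_ +i* _)%C;
  exact: (congr1 (@^~ x) (mderiv0 alpha)).
Qed.

End ComplexFunctions.

Section Nets.
Context {R : realType} {m : nat}.

Definition eps_index : Type := {e : R | 0 < e <= 1}.
Definition net : Type := eps_index -> 'rV[R]_m -> R[i].
HB.instance Definition _ := GRing.Zmodule.on net.
HB.instance Definition _ := Choice.on net.

Implicit Types (u v w : net) (K : set 'rV[R]_m) (A : set ('I_m -> nat)).

(* The supremum over the empty set is -oo here, which is harmless since these
   suprema only occur on the left of upper bounds. *)
Definition sup_deriv K A (f : 'rV[R]_m -> R[i]) : \bar R :=
  ereal_sup [set (Normc.normc (cmderiv p.1 f p.2))%:E | p in A `*` K].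

(* s_eps = O(eps^b) as eps -> 0 *)
Definition is_bigO (s : eps_index -> \bar R) (b : R) : Prop :=
  exists C eta : R, 0 < eta /\
    forall e : eps_index, sval e < eta -> (s e <= (C * sval e `^ b)%:E)%E.

Definition moderate u : Prop := (forall e, csmooth (u e)) /\
  forall K, compact K -> forall alpha, exists N : nat,
    is_bigO (fun e => sup_deriv K [set alpha] (u e)) (- N%:R).

Definition negligible u : Prop := (forall e, csmooth (u e)) /\
  forall K, compact K -> forall alpha, forall q : nat,
    is_bigO (fun e => sup_deriv K [set alpha] (u e)) q%:R.

Lemma sup_derivP K A f (c : R) :
  (sup_deriv K A f <= c%:E)%E <->
  forall alpha x, A alpha -> K x -> Normc.normc (cmderiv alpha f x) <= c.
Proof.
split=> [/ereal_supP H alpha x Aa Kx|H].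
  by rewrite -lee_fin; apply: H; exists (alpha, x).
by apply/ereal_supP => _ [[alpha x] [/= Aa Kx] <-]; rewrite lee_fin H.
Qed.

Lemma is_bigO_sup_derivP K A u b :
  is_bigO (fun e => sup_deriv K A (u e)) b <->
  exists C eta : R, [/\ 0 <= C, 0 < eta & forall e : eps_index, sval e < eta ->
    forall alpha x, A alpha -> K x ->
    Normc.normc (cmderiv alpha (u e) x) <= C * sval e `^ b].
Proof.
split=> [[C [eta [eta0 H]]]|[C [eta [C0 eta0 H]]]]; last first.
  by exists C, eta; split=> // e /H ?; exact/sup_derivP.
exists `|C|, eta; split=> // e /H /sup_derivP {}H alpha x Aa Kx.
by apply: le_trans (H _ _ Aa Kx) _; rewrite ler_wpM2r ?powR_ge0 ?ler_norm.
Qed.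

Lemma is_bigO_le (s : eps_index -> \bar R) (b b' : R) :
  b' <= b -> is_bigO s b -> is_bigO s b'.
Proof.
move=> bb' [C [eta [eta0 H]]]; exists `|C|, eta; split=> // e /H.
move=> /le_trans; apply; rewrite lee_fin.
have /andP[e0 e1] := svalP e.
apply: (@le_trans _ _ (`|C| * sval e `^ b)).
  by rewrite ler_wpM2r ?powR_ge0 ?ler_norm.
by rewrite ler_wpM2l// ger_powR// e0.
Qed.

Lemma is_bigOB K A u v b :
  (forall e, csmooth (u e)) -> (forall e, csmooth (v e)) ->
  is_bigO (fun e => sup_deriv K A (u e)) b ->
  is_bigO (fun e => sup_deriv K A (v e)) b ->
  is_bigO (fun e => sup_deriv K A ((u - v) e)) b.
Proof.
move=> su sv /is_bigO_sup_derivP[C [eta [C0 eta0 H]]].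
move=> /is_bigO_sup_derivP[D [eta' [D0 eta'0 H']]].
apply/is_bigO_sup_derivP; exists (C + D), (Num.min eta eta').
split=> [||e]; [exact: addr_ge0|by rewrite lt_min eta0|].
rewrite lt_min => /andP[/H{}H /H'{}H'] alpha x Aa Kx.
rewrite (_ : (u - v) e = u e - v e)// cmderivB// fctE mulrDl.
apply: le_trans (le_normcD (_ : Rcomplex R) _) _; rewrite normcN.
by apply: lerD; [exact: H|exact: H'].
Qed.

Lemma is_bigO0 K A b : is_bigO (fun e => sup_deriv K A ((0 : net) e)) b.
Proof.
apply/is_bigO_sup_derivP; exists 0, 1; split=> // e _ alpha x _ _.
by rewrite (_ : (0 : net) e = 0)// cmderiv0 mul0r [X in X <= _]Normc.normc0.
Qed.

Definition moderate_pred : {pred net} := fun u => `[< moderate u >].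

Lemma moderate_zmod_closed : zmod_closed moderate_pred.
Proof.
split.
  apply/asboolP; split=> [e|K cK alpha]; first exact: csmooth0.
  by exists 0%N; exact: is_bigO0.
move=> u v /asboolP[su mu] /asboolP[sv mv]; apply/asboolP; split=> [e|].
  exact: csmoothB.
move=> K cK alpha; have [[N HN] [M HM]] := (mu K cK alpha, mv K cK alpha).
exists (maxn N M); apply: is_bigOB => //.
  by apply: is_bigO_le HN; rewrite lerN2 ler_nat leq_maxl.
by apply: is_bigO_le HM; rewrite lerN2 ler_nat leq_maxr.
Qed.

HB.instance Definition _ := GRing.isZmodClosed.Build net moderate_pred
  moderate_zmod_closed.

Record EM := MkEM { EM_val : net; EM_valP : EM_val \in moderate_pred }.
HB.instance Definition _ := [isSub for EM_val].
HB.instance Definition _ := [Choice of EM by <:].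
HB.instance Definition _ := [SubChoice_isSubZmodule of EM by <:].

Lemma EM_moderate (u : EM) : moderate (EM_val u).
Proof. exact/asboolP/EM_valP. Qed.

Definition negligible_pred : {pred EM} := fun u : EM => `[< negligible (EM_val u) >].

Lemma negligible_zmod_closed : zmod_closed negligible_pred.
Proof.
split.
  apply/asboolP; split=> [e|K cK alpha q]; first exact: csmooth0.
  exact: is_bigO0.
move=> u v /asboolP[su nu] /asboolP[sv nv]; apply/asboolP; split=> [e|].
  exact: csmoothB.
by move=> K cK alpha q; apply: is_bigOB; [| |exact: nu|exact: nv].
Qed.

HB.instance Definition _ := GRing.isZmodClosed.Build EM negligible_pred
  negligible_zmod_closed.

End Nets.

Arguments eps_index : clear implicits.
Arguments net : clear implicits.
Arguments EM : clear implicits.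

Definition colombeau (R : realType) (m : nat) : Type :=
  Quotient.quot (@negligible_pred R m).
HB.instance Definition _ (R : realType) (m : nat) :=
  GRing.Zmodule.on (colombeau R m).
HB.instance Definition _ (R : realType) (m : nat) :=
  EqQuotient.on (colombeau R m).
HB.instance Definition _ (R : realType) (m : nat) :=
  isPointed.Build (colombeau R m) 0.

Lemma pi_colombeauP (R : realType) (m : nat) (u v : EM R m) :
  \pi_(colombeau R m) u = \pi_(colombeau R m) v <-> negligible (EM_val (u - v)).
Proof.
split=> [/eqP|H].
  by rewrite -[colombeau R m]/(Quotient.quot _) piE Quotient.equivE => /asboolP.
apply/eqP; rewrite -[colombeau R m]/(Quotient.quot _) piE Quotient.equivE.
exact/asboolP.
Qed.

Section Operations.
Context {R : realType}.

Section Derivatives.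
Context {m : nat} (i : 'I_m).

Definition net_pderiv (u : net R m) : net R m := fun e => cpderiv i (u e).

Let is_bigO_pderiv (u : net R m) K alpha b : (forall e, csmooth (u e)) ->
  is_bigO (fun e => sup_deriv K [set mincr i alpha] (u e)) b ->
  is_bigO (fun e => sup_deriv K [set alpha] (net_pderiv u e)) b.
Proof.
move=> su /is_bigO_sup_derivP[C [eta [C0 eta0 H]]].
apply/is_bigO_sup_derivP; exists C, eta; split=> // e ee _ x -> Kx.
by rewrite cmderiv_cpderiv//; exact: H.
Qed.

Lemma moderate_pderiv (u : EM R m) : net_pderiv (EM_val u) \in moderate_pred.
Proof.
have [su mu] := EM_moderate u; apply/asboolP; split=> [e|K cK alpha].
  exact: csmooth_cpderiv.
by have [N HN] := mu K cK (mincr i alpha); exists N; exact: is_bigO_pderiv.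
Qed.

Lemma negligible_pderiv (u : net R m) : negligible u -> negligible (net_pderiv u).
Proof.
move=> [su nu]; split=> [e|K cK alpha q]; first exact: csmooth_cpderiv.
by apply: is_bigO_pderiv => //; exact: nu.
Qed.

Definition EM_pderiv (u : EM R m) : EM R m := MkEM (moderate_pderiv u).

Definition gpderiv (u : colombeau R m) : colombeau R m :=
  \pi_(colombeau R m) (EM_pderiv (repr u)).

Lemma gpderiv_pi (u : EM R m) :
  gpderiv (\pi_(colombeau R m) u) = \pi_(colombeau R m) (EM_pderiv u).
Proof.
apply/pi_colombeauP.
have /pi_colombeauP H : repr (\pi_(colombeau R m) u) = u %[mod colombeau R m].
  by rewrite reprK.
have := negligible_pderiv H.
congr (negligible _); apply/funext => e; rewrite /net_pderiv /=.
have [[sr _] [su _]] := (EM_moderate (repr (\pi_(colombeau R m) u)), EM_moderate u).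
exact: cpderivB.
Qed.

End Derivatives.

Section Restriction.
Context {n : nat}.

Definition net_restr0 (u : net R (n + 1)) : net R n :=
  fun e => u e \o embed0.

Let is_bigO_restr0 (u : net R (n + 1)) K alpha b :
  is_bigO (fun e => sup_deriv (embed0 @` K) [set mlift alpha] (u e)) b ->
  is_bigO (fun e => sup_deriv K [set alpha] (net_restr0 u e)) b.
Proof.
move=> /is_bigO_sup_derivP[C [eta [C0 eta0 H]]].
apply/is_bigO_sup_derivP; exists C, eta; split=> // e ee _ x -> Kx.
rewrite (_ : cmderiv _ _ _ = cmderiv (mlift alpha) (u e) (embed0 x)).
  by apply: H => //; exists x.
rewrite /cmderiv /cmap; congr (_ +i* _)%C;
  by rewrite -[RHS]/((_ \o embed0) x) -mderiv_embed0.
Qed.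

Let compact_embed0 (K : set 'rV[R]_n) : compact K -> compact (embed0 @` K).
Proof.
move=> cK; apply: continuous_compact => //.
by apply: continuous_subspaceT; exact: embed0_continuous.
Qed.

Lemma moderate_restr0 (u : EM R (n + 1)) :
  net_restr0 (EM_val u) \in moderate_pred.
Proof.
have [su mu] := EM_moderate u; apply/asboolP; split=> [e|K cK alpha].
  by have [sr si] := su e; split; [exact: smooth_embed0 sr|exact: smooth_embed0 si].
have [N HN] := mu _ (compact_embed0 cK) (mlift alpha).
by exists N; exact: is_bigO_restr0.
Qed.

Lemma negligible_restr0 (u : net R (n + 1)) :
  negligible u -> negligible (net_restr0 u).
Proof.
move=> [su nu]; split=> [e|K cK alpha q].
  by have [sr si] := su e; split; [exact: smooth_embed0 sr|exact: smooth_embed0 si].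
by apply: is_bigO_restr0; apply: nu; exact: compact_embed0.
Qed.

Definition EM_restr0 (u : EM R (n + 1)) : EM R n := MkEM (moderate_restr0 u).

Definition grestr0 (u : colombeau R (n + 1)) : colombeau R n :=
  \pi_(colombeau R n) (EM_restr0 (repr u)).

Lemma grestr0_pi (u : EM R (n + 1)) :
  grestr0 (\pi_(colombeau R (n + 1)) u) = \pi_(colombeau R n) (EM_restr0 u).
Proof.
apply/pi_colombeauP.
have /pi_colombeauP H : repr (\pi_(colombeau R (n + 1)) u) = u
  %[mod colombeau R (n + 1)] by rewrite reprK.
exact: negligible_restr0 H.
Qed.

End Restriction.

End Operations.

Section SharpTopology.
Context {R : realType} {m : nat}.
Implicit Types (K : set 'rV[R]_m) (j : nat) (u : colombeau R m).

Definition net_valuation K j (u : net R m) : \bar R :=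
  ereal_sup [set b%:E | b in
    [set b : R | is_bigO
       (fun e => sup_deriv K [set alpha | (mdegree alpha <= j)%N] (u e)) b]].

Definition valuation K j u : \bar R := net_valuation K j (EM_val (repr u)).

Let is_bigO_degree K j (u : net R m) b :
  (forall alpha, is_bigO (fun e => sup_deriv K [set alpha] (u e)) b) ->
  is_bigO (fun e => sup_deriv K [set alpha | (mdegree alpha <= j)%N] (u e)) b.
Proof.
move=> H; pose toN (f : {ffun 'I_m -> 'I_j.+1}) i : nat := f i.
have {H} : forall s : seq {ffun 'I_m -> 'I_j.+1}, is_bigO
    (fun e => sup_deriv K [set toN f | f in [set` s]] (u e)) b.
  elim=> [|f s /is_bigO_sup_derivP[C [eta [C0 eta0 IH]]]].
    by apply/is_bigO_sup_derivP; exists 0, 1; split=> // e _ alpha x [].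
  have /is_bigO_sup_derivP[D [eta' [D0 eta'0 Hf]]] := H (toN f).
  apply/is_bigO_sup_derivP; exists (C + D), (Num.min eta eta').
  split=> [||e]; [exact: addr_ge0|by rewrite lt_min eta0|].
  rewrite lt_min => /andP[/IH{}IH /Hf{}Hf] _ x [g /= + <-] Kx.
  rewrite inE mulrDl => /orP[/eqP ->|gs].
    by rewrite -[leLHS]add0r lerD ?mulr_ge0 ?powR_ge0//; exact: Hf.
  rewrite -[leLHS]addr0 lerD ?mulr_ge0 ?powR_ge0//; apply: IH => //.
  by exists g.
move=> /(_ (enum {: {ffun 'I_m -> 'I_j.+1}})).
move=> /is_bigO_sup_derivP[C [eta [C0 eta0 H]]].
apply/is_bigO_sup_derivP; exists C, eta; split=> // e ee alpha x /= aj.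
apply: H => //; exists [ffun i => inord (alpha i)]; first by rewrite /= mem_enum.
apply/funext => i; rewrite /toN ffunE inordK// ltnS (leq_trans _ aj)//.
by rewrite /mdegree (bigD1 i)//= leq_addr.
Qed.

Lemma valuation_pi K j (u : EM R m) : compact K ->
  valuation K j (\pi_(colombeau R m) u) = net_valuation K j (EM_val u).
Proof.
move=> cK; rewrite /valuation.
suff H (v w : EM R m) : v = w %[mod colombeau R m] -> forall b,
    is_bigO (fun e => sup_deriv K [set alpha | (mdegree alpha <= j)%N]
      (EM_val v e)) b ->
    is_bigO (fun e => sup_deriv K [set alpha | (mdegree alpha <= j)%N]
      (EM_val w e)) b.
  have E : repr (\pi_(colombeau R m) u) = u %[mod colombeau R m] by rewrite reprK.
  by congr (ereal_sup (_ @` _)); apply/seteqP; split=> b /=; exact: H.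
move=> /pi_colombeauP[svw nvw] b bv.
have [[sv _] [sw _]] := (EM_moderate v, EM_moderate w).
rewrite (_ : EM_val w = EM_val v - EM_val (v - w)); last first.
  by rewrite -[EM_val (v - w)]/(EM_val v - EM_val w) subKr.
apply: is_bigOB => //; apply: is_bigO_degree => alpha.
have [q bq] : exists q : nat, b <= q%:R.
  by exists (Num.bound `|b|); rewrite (le_trans (ler_norm b))// ltW// archi_boundP.
by apply: is_bigO_le bq _; exact: nvw.
Qed.

(* The value lies in [0, +oo[; it is 0 when the valuation is +oo. *)
Definition pseudo_seminorm K j u : \bar R := expeR (- valuation K j u).

Definition seminorm_ball K j (u0 : colombeau R m) (r : R) : set (colombeau R m) :=
  [set u | (pseudo_seminorm K j (u - u0)%R < r%:E)%E].

(* The coarsest topology in which the balls of all the pseudo-seminorms are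
   open. *)
HB.instance Definition _ := @isSubBaseTopological.Build (colombeau R m)
  (set 'rV[R]_m * nat * colombeau R m * R)%type
  [set p | compact p.1.1.1 /\ 0 < p.2]
  (fun p => seminorm_ball p.1.1.1 p.1.1.2 p.1.2 p.2).

End SharpTopology.

Section WaveEquation.
Context {R : realType} {n : nat}.

(* Points (x, t) of R^(n+1) are rows row_mx x t%:M: the first n coordinates
   are those of x and the last one is t. *)
Definition dt : colombeau R (n + 1) -> colombeau R (n + 1) :=
  gpderiv (rshift n ord0).

Definition dx (i : 'I_n) : colombeau R (n + 1) -> colombeau R (n + 1) :=
  gpderiv (lshift 1 i).

Definition laplacian (u : colombeau R (n + 1)) : colombeau R (n + 1) :=
  \sum_(i < n) dx i (dx i u).

Definition wave_cauchy (c d : colombeau R n) (f u : colombeau R (n + 1)) : Prop :=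
  [/\ dt (dt u) - laplacian u = f, grestr0 u = c & grestr0 (dt u) = d].

End WaveEquation.

(* Main.v *)
Require Import Defs.
From mathcomp Require Import all_boot all_order all_algebra.
From mathcomp Require Import generic_quotient ring_quotient.
From mathcomp Require Import all_classical all_reals all_analysis.
From mathcomp Require Import finmap complex lra ring.

(** Componentwise, the claim reduces to an a priori estimate for smooth real
    functions: the derivatives of order <= j of [w] on a compact set are bounded
    by finitely many derivatives of [w] and [d_t w] on a box at t = 0 and of
    [wave_op w] on a space-time box.  It comes from the energy identity for the
    density [w^2 + |grad w|^2], localised by the weight
    [max (0, M^2 - A |t| - |x|^2)^2] with A so large that the flux through the
    level sets of the weight has the right sign, followed by Gronwall's lemma, a
    Sobolev inequality in each coordinate, and the equation itself to compute
    all time derivatives at t = 0.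

    Integration over boxes is replaced by Riemann sums of step 1/N.  These are
    finite, so that they commute with each other and with d_t, while
    integration by parts and the Sobolev inequality hold up to errors that
    vanish as N tends to infinity, [w] being fixed. *)

Set Implicit Arguments.
Unset Strict Implicit.
Unset Printing Implicit Defensive.

Import Order.TTheory GRing.Theory Num.Theory.
Import numFieldNormedType.Exports.

Local Open Scope classical_set_scope.
Local Open Scope ring_scope.

(* [EM] alone is the excluded middle of [boolp]. *)
Local Notation EM := Defs.EM.

(** The constants of the real estimate must not depend on [w], since it is applied to the real and
    imaginary parts of every member of a net; only N may depend on [w], hence on epsilon, and N is
    gone before nets come back. A factor independent of epsilon does not change the order b in
    O(eps^b), so the resulting estimate between pseudo-seminorms has the same radius on both sides,
    and by linearity it gives continuity. The weight vanishes on the lateral faces of the box, so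
    that integration by parts leaves no boundary terms, and its square makes it C^1, which is all
    that the discrete integration by parts asks for. The slope A = 2 M m balances fewer than m
    spatial slopes 2 |x_i| <= 2 M. The term w^2 in the density lets the energy control [w] itself,
    so that the Sobolev inequality can be fed with one derivative of [w] at a time. A sign [sigma]
    treats both directions of time. *)

Section DeriveOps.
Context {R : realType} {V : normedModType R}.

Lemma is_derive_mul (f g : V -> R) (x v : V) (df dg : R) :
  is_derive x v f df -> is_derive x v g dg ->
  is_derive x v (fun y => f y * g y) (df * g x + f x * dg).
Proof.
move=> hf hg; have -> : df * g x + f x * dg = f x *: dg + g x *: df.
  by rewrite addrC [g x *: _]mulrC.
exact: is_deriveM.
Qed.

Lemma is_derive_add (f g : V -> R) (x v : V) (df dg : R) :
  is_derive x v f df -> is_derive x v g dg ->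
  is_derive x v (fun y => f y + g y) (df + dg).
Proof. exact: is_deriveD. Qed.

End DeriveOps.

(** * Derivatives from Taylor bounds, and uniform continuity on compact sets *)

Section Calculus.
Context {R : realType} {m : nat}.
Implicit Types (g : 'rV[R]_m -> R) (x y v : 'rV[R]_m).

Lemma is_derive_bigsum (I : Type) (s : seq I) (P : pred I)
    (f : I -> 'rV[R]_m -> R) (df : I -> R) x v :
  (forall i, P i -> is_derive x v (f i) (df i)) ->
  is_derive x v (fun y => \sum_(i <- s | P i) f i y) (\sum_(i <- s | P i) df i).
Proof.
move=> h; elim: s => [|i s IH].
  rewrite big_nil [X in is_derive _ _ X](_ : _ = cst 0); last first.
    by apply/funext => y; rewrite big_nil.
  exact: is_derive_cst.
rewrite big_cons; under [X in is_derive _ _ X]eq_fun do rewrite big_cons.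
by case: ifPn => // Pi; apply: is_derive_add => //; exact: h.
Qed.

(** Meant for the weight, which is only C^1 but has a quadratic Taylor remainder. *)
Lemma is_derive_quadratic_error g x v (l C : R) :
  (forall h, `|h| <= 1 -> `|g (x + h *: v) - g x - h * l| <= C * h ^+ 2) ->
  is_derive x v g l.
Proof.
move=> H; have C0 : 0 <= C.
  by have := H 1; rewrite normr1 expr1n mulr1 => /(_ (lexx _)); apply: le_trans.
have L : h^-1 *: ((g \o shift x) (h *: v) - g x) @[h --> 0^'] --> l.
  apply/cvgrPdist_le => e e0.
  near=> h; have h0 : h != 0 by near: h; exact: nbhs_dnbhs_neq.
  have h1 : `|h| <= 1.
    near: h; apply: dnbhs0_le; exact: ltr01.
  have he : `|h| <= e / (C + 1).
    by near: h; apply: dnbhs0_le; rewrite divr_gt0// ltr_wpDl.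
  rewrite /= distrC -(mulKf h0 l) -mulrBr normrM normfV [h *: v + x]addrC.
  rewrite ler_pdivrMl ?normr_gt0//; apply: le_trans (H _ h1) _.
  rewrite -real_normK ?num_real// expr2 mulrCA ler_wpM2l//.
  apply: le_trans (ler_wpM2l C0 he) _.
  by rewrite mulrCA ger_pMr// ler_pdivrMr ?ltr_wpDl// mul1r lerDl.
split; first by apply/cvg_ex; exists l.
exact: cvg_lim L.
Unshelve. all: by end_near.
Qed.

Lemma compact_unif_continuous (K : set 'rV[R]_m) g (e : R) :
  compact K -> continuous g -> 0 < e ->
  exists2 d : R, 0 < d &
    forall x y, K x -> `|x - y| < d -> `|g x - g y| < e.
Proof.
move=> /compact_near_coveringP cK cg e0.
pose P (d : R) x := forall y, `|x - y| < d -> `|g x - g y| < e.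
have : \forall d \near (0 : R)^'+, K `<=` P d.
  apply: cK => x _; have /cvgrPdist_lt /(_ (e / 2)) := cg x.
  rewrite divr_gt0// => /(_ isT) /nbhs_normP[r /= r0 gr].
  (* With half the radius, a point within d of z is still within r of x; comparing both values with
     [g x] costs e / 2 each. *)
  exists ([set y | `|x - y| < r / 2], [set d | d < r / 2]) => /=.
    split; last by apply: nbhs_right_lt; rewrite divr_gt0.
    have := nbhsx_ballx x (r / 2); rewrite -ball_normE; apply.
    by rewrite divr_gt0.
  move=> [z d] /= [xz dr] y zy; have Ez := gr z; have Ey := gr y.
  have xy : `|x - y| < r.
    rewrite -(subrKA z) [r]splitr; apply: le_lt_trans (ler_normD _ _) _.
    by rewrite ltrD// (lt_trans zy).
  have {}xz : `|x - z| < r by apply: lt_trans xz _; rewrite gtr_pMr// invf_lt1// ltr1n.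
  rewrite -(subrKA (g x)) [e]splitr; apply: le_lt_trans (ler_normD _ _) _.
  apply: ltrD; first by rewrite distrC; exact: Ez.
  exact: Ey.
move=> KP; near (0 : R)^'+ => d.
have Kd : K `<=` P d by near: d.
by exists d => // x y Kx; exact: Kd.
Unshelve. all: by end_near. Qed.

End Calculus.

(** * Riemann sums in one and several coordinates *)

Section GridMeans.
Context {R : realType} {m : nat}.
Implicit Types (g G H : 'rV[R]_m -> R) (x y : 'rV[R]_m) (i : 'I_m).

(** A translation along ['e_i] rather than a new row, so that derivatives along ['e_i] apply to it
    directly. *)
Definition upd x i (s : R) : 'rV[R]_m := x + (s - x 0 i) *: 'e_i.

Lemma updE x i (s : R) j : upd x i s 0 j = if j == i then s else x 0 j.
Proof.
rewrite /upd !mxE eqxx /=; case: eqVneq => [->|_] /=; last by rewrite mulr0 addr0.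
by rewrite mulr1 addrC subrK.
Qed.

Lemma updC x i j (a b : R) : i != j -> upd (upd x i a) j b = upd (upd x j b) i a.
Proof.
move=> ij; apply/rowP => k; rewrite !updE.
by case: eqVneq => [->|//]; rewrite eq_sym (negbTE ij).
Qed.

Lemma upd_shift x i j (a h : R) : i != j ->
  upd (x + h *: 'e_j) i a = upd x i a + h *: 'e_j.
Proof.
move=> ij; apply/rowP => k; rewrite !(updE, mxE) eqxx /=.
by case: eqVneq => // ->; rewrite (negbTE ij) mulr0 addr0.
Qed.

Definition node (M N k : nat) : R := k%:R / N%:R - M%:R.

Lemma node_bound M N k : (k <= 2 * M * N)%N -> `|node M N k| <= M%:R.
Proof.
move=> kM; rewrite ler_norml /node lerBrDr addNr divr_ge0//=.
(* For N = 0 the hypothesis forces k = 0, and the node is - M. *)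
case: N kM => [|N]; first by rewrite muln0 leqn0 => /eqP ->; rewrite mul0r lerBlDr addr_ge0.
move=> kM; rewrite lerBlDr ler_pdivrMr// -natrD -natrM ler_nat.
by rewrite addnn -mul2n.
Qed.

Lemma nodeS M N k : (0 < N)%N -> node M N k.+1 = node M N k + N%:R^-1.
Proof. by move=> N0; rewrite /node -natr1 mulrDl mul1r addrAC. Qed.

Lemma node0 M N : node M N 0 = - M%:R.
Proof. by rewrite /node mul0r sub0r. Qed.

Lemma node_last M N : (0 < N)%N -> node M N (2 * M * N) = M%:R.
Proof.
move=> N0; rewrite /node natrM mulfK ?pnatr_eq0 -?lt0n// natrM mulr_natl mulr2n.
by rewrite addrK.
Qed.

(* The Riemann sum of step 1/N for the integral over [-M, M] in the i-th
   coordinate. *)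
Definition rsum (M N : nat) i G : 'rV[R]_m -> R :=
  fun x => N%:R^-1 * \sum_(k < 2 * M * N) G (upd x i (node M N k)).

Definition rsums (M N : nat) (s : seq 'I_m) G : 'rV[R]_m -> R :=
  foldr (rsum M N) G s.

Lemma rsumD M N i G H : rsum M N i (fun x => G x + H x) =
  fun x => rsum M N i G x + rsum M N i H x.
Proof. by apply/funext => x; rewrite /rsum big_split mulrDr. Qed.

Lemma rsumZ M N i c G : rsum M N i (fun x => c * G x) =
  fun x => c * rsum M N i G x.
Proof. by apply/funext => x; rewrite /rsum -mulr_sumr mulrCA. Qed.

Lemma rsumsD M N s G H : rsums M N s (fun x => G x + H x) =
  fun x => rsums M N s G x + rsums M N s H x.
Proof. by elim: s => //= i s ->; rewrite rsumD. Qed.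

Lemma rsumsZ M N s c G : rsums M N s (fun x => c * G x) =
  fun x => c * rsums M N s G x.
Proof. by elim: s => //= i s ->; rewrite rsumZ. Qed.

Lemma rsumC M N i j G :
  rsum M N i (rsum M N j G) = rsum M N j (rsum M N i G).
Proof.
have [->//|ij] := eqVneq i j; apply/funext => x; rewrite /rsum; congr (_ * _).
rewrite -!mulr_sumr exchange_big /=; congr (_ * _).
by apply: eq_bigr => k _; apply: eq_bigr => l _; rewrite updC.
Qed.

Lemma rsum_rsums M N s i G :
  rsum M N i (rsums M N s G) = rsums M N s (rsum M N i G).
Proof. by elim: s => //= j s <-; rewrite rsumC. Qed.

(** Moves the sum in direction i innermost, where it can meet a derivative in direction i. *)
Lemma rsums_rem M N s i G : i \in s ->
  rsums M N s G = rsums M N (rem i s) (rsum M N i G).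
Proof.
elim: s => //= j s IH; rewrite inE.
have [->|ij] := eqVneq i j; first by rewrite rsum_rsums.
by move=> /= ins; rewrite IH.
Qed.

Lemma rsum_le (D : set 'rV[R]_m) M N i G H x :
  (forall a : R, `|a| <= M%:R -> D (upd x i a)) ->
  (forall y, D y -> G y <= H y) -> rsum M N i G x <= rsum M N i H x.
Proof.
move=> Du GH; rewrite /rsum ler_wpM2l ?invr_ge0//; apply: ler_sum => k _.
by apply/GH/Du/node_bound/ltnW.
Qed.

Lemma rsums_le (D : set 'rV[R]_m) M N s G H x :
  (forall i y (a : R), i \in s -> D y -> `|a| <= M%:R -> D (upd y i a)) ->
  D x -> (forall y, D y -> G y <= H y) -> rsums M N s G x <= rsums M N s H x.
Proof.
elim: s x => [|i s IH] x Du Dx GH; first exact: GH.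
apply: (@rsum_le D) => [a aM|y Dy]; first by apply: Du => //; rewrite mem_head.
by apply: IH => // j z a js; apply: Du; rewrite inE js orbT.
Qed.

Lemma rsum_cst M N i (c : R) x : (0 < N)%N ->
  rsum M N i (fun=> c) x = (2 * M)%:R * c.
Proof.
move=> N0; rewrite /rsum sumr_const card_ord -[c *+ _]mulr_natl mulrA; congr (_ * c).
by rewrite natrM mulrCA mulVf ?mulr1// pnatr_eq0 -lt0n.
Qed.

Lemma rsums_cst M N s (c : R) x : (0 < N)%N ->
  rsums M N s (fun=> c) x = (2 * M)%:R ^+ size s * c.
Proof.
move=> N0; elim: s x => [|i s IH] x /=; first by rewrite mul1r.
rewrite (_ : rsums _ _ _ _ = fun=> (2 * M)%:R ^+ size s * c); last exact/funext.
by rewrite rsum_cst// mulrA -exprS.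
Qed.

(** As M and M' are integers and the step is the same, the nodes of the smaller interval are nodes
    of the larger one. *)
Lemma rsum_mono M M' N i G x : (M' <= M)%N ->
  (forall y, 0 <= G y) -> rsum M' N i G x <= rsum M N i G x.
Proof.
move=> MM G0; rewrite /rsum ler_wpM2l ?invr_ge0//.
case: N => [|N]; first by rewrite !muln0 !big_ord0.
(* The number of nodes in [-M, -M'), which is the shift of the index. *)
pose d := ((M - M') * N.+1)%N.
have nE k : node M' N.+1 k = node M N.+1 (k + d).
  rewrite /node /d natrD mulrDl natrM mulfK ?pnatr_eq0// natrB//.
  by ring.
rewrite (eq_bigr (fun k : 'I__ => G (upd x i (node M N.+1 (k + d))))); last first.
  by move=> k _; rewrite nE.
rewrite -(big_mkord xpredT (fun k => G (upd x i (node M N.+1 (k + d))))).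
rewrite -(big_mkord xpredT (fun k => G (upd x i (node M N.+1 k)))).
have E : (2 * M * N.+1 = 2 * M' * N.+1 + d + d)%N.
  rewrite /d -addnA addnn -mul2n mulnA -mulnDl -mulnDr subnKC//.
rewrite E [leRHS](@big_cat_nat _ _ _ (2 * M' * N.+1 + d)%N) ?leq_addr//=.
rewrite [X in _ <= X + _](@big_cat_nat _ _ _ d) ?leq_addl//=.
rewrite -{3}[d]add0n big_addn addnK.
rewrite -[leLHS]addr0 lerD ?sumr_ge0//.
by rewrite -[leLHS]add0r lerD ?sumr_ge0.
Qed.

Lemma rsums_ge0 M N s G x : (forall y, 0 <= G y) -> 0 <= rsums M N s G x.
Proof.
move=> G0; elim: s x => //= i s IH x.
by rewrite mulr_ge0 ?invr_ge0// sumr_ge0.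
Qed.

Lemma rsums_mono M M' N s G x : (M' <= M)%N ->
  (forall y, 0 <= G y) -> rsums M' N s G x <= rsums M N s G x.
Proof.
move=> MM G0; elim: s x => //= i s IH x.
apply: le_trans (_ : rsum M' N i (rsums M N s G) x <= _).
  by apply: (@rsum_le setT).
by apply: rsum_mono => // y; exact: rsums_ge0.
Qed.

Lemma is_derive_upd i j G (dG : R) x (a : R) : i != j ->
  is_derive (upd x i a) 'e_j G dG ->
  is_derive x 'e_j (fun y => G (upd y i a)) dG.
Proof.
move=> ij [D1 D2]; have E : (fun h : R => h^-1 *:
    (((fun y => G (upd y i a)) \o shift x) (h *: 'e_j) - G (upd x i a))) =
   (fun h : R => h^-1 *: ((G \o shift (upd x i a)) (h *: 'e_j) - G (upd x i a))).
  apply/funext => h /=; congr (_ *: (G _ - _)).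
  by rewrite addrC upd_shift// addrC.
by split; rewrite ?/derivable ?/derive E.
Qed.

Lemma is_derive_rsum M N i j G (dG : 'rV[R]_m -> R) x : i != j ->
  (forall y, is_derive y 'e_j G (dG y)) ->
  is_derive x 'e_j (rsum M N i G) (rsum M N i dG x).
Proof.
move=> ij hG; rewrite /rsum -[_ * _]addr0 -[X in _ + X](mul0r
   (\sum_(k < 2 * M * N) G (upd x i (node M N k)))) addrC.
apply: (@is_derive_mul _ _ (cst (N%:R^-1))).
apply: is_derive_bigsum => k _; exact: is_derive_upd.
Qed.

Lemma is_derive_rsums M N s j G (dG : 'rV[R]_m -> R) x : j \notin s ->
  (forall y, is_derive y 'e_j G (dG y)) ->
  is_derive x 'e_j (rsums M N s G) (rsums M N s dG x).
Proof.
move=> + hG; elim: s x => [|i s IH] x /=; first by move=> _; exact: hG.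
rewrite inE negb_or eq_sym => /andP[ij js]; apply: is_derive_rsum => // y.
exact: IH.
Qed.

End GridMeans.

(** * Discrete integration by parts, and the Sobolev inequality along one axis *)

Section GridCalculus.
Context {R : realType} {m : nat}.
Implicit Types (g dg G : 'rV[R]_m -> R) (x y : 'rV[R]_m) (i : 'I_m) (s : seq 'I_m).

Definition cube (L : nat) : set 'rV[R]_m := [set x | forall i, `|x 0 i| <= L%:R].

Lemma compact_cube L : compact (cube L).
Proof.
rewrite (_ : cube L =
  [set x : 'rV[R]_m | forall i, [set` `[- L%:R, L%:R : R]] (x ord0 i)]).
  exact: (@rV_compact R m (fun=> `[- L%:R, L%:R]%classic)
    (fun=> @segment_compact _ _ _)).
by apply/seteqP; split=> x h i; have := h i; rewrite /= in_itv/= ler_norml.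
Qed.

Lemma continuous_mul (f g : 'rV[R]_m -> R) :
  continuous f -> continuous g -> continuous (fun x => f x * g x).
Proof. by move=> cf cg x; apply: continuousM; [exact: cf|exact: cg]. Qed.

Lemma continuous_add (f g : 'rV[R]_m -> R) :
  continuous f -> continuous g -> continuous (fun x => f x + g x).
Proof. by move=> cf cg x; apply: continuousD; [exact: cf|exact: cg]. Qed.

Lemma continuous_exp2 g : continuous g -> continuous (fun x => g x ^+ 2).
Proof.
by move=> cg; under eq_fun do rewrite expr2; exact: continuous_mul.
Qed.

Lemma continuous_bigsum (I : Type) (r : seq I) (P : pred I)
    (f : I -> 'rV[R]_m -> R) :
  (forall j, continuous (f j)) -> continuous (fun x => \sum_(j <- r | P j) f j x).
Proof.
move=> cf; elim: r => [|j r IH].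
  by under eq_fun do rewrite big_nil; exact: cst_continuous.
under eq_fun do rewrite big_cons; case: (P j) => //.
exact: continuous_add.
Qed.

Lemma continuous_cst (c : R) : continuous (fun _ : 'rV[R]_m => c).
Proof. exact: cst_continuous. Qed.

Lemma upd_line x i (a : R) : upd x i a = upd x i 0 + a *: 'e_i.
Proof. by rewrite /upd sub0r scaleNr scalerBl addrA addrAC. Qed.

Lemma upd_self x i : upd x i (x 0 i) = x.
Proof. by rewrite /upd subrr scale0r addr0. Qed.

Lemma upd_dist x i (a b : R) : `|upd x i a - upd x i b| <= `|a - b|.
Proof.
rewrite [leLHS]mx_normrE; apply/bigmax_leP; split=> // -[k j] _ /=.
have -> : (upd x i a - upd x i b) k j = upd x i a 0 j - upd x i b 0 j.
  by rewrite !mxE ord1.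
rewrite !updE.
by case: eqVneq => // _; rewrite subrr normr0.
Qed.

Lemma coord_MVT i g dg x (a b : R) :
  (forall y, is_derive y 'e_i g (dg y)) -> a <= b ->
  exists2 c, a <= c <= b &
    g (upd x i b) - g (upd x i a) = dg (upd x i c) * (b - a).
Proof.
move=> hg ab; pose phi (t : R) := g (upd x i 0 + t *: 'e_i).
have dphi (t : R) : is_derive t 1 phi (dg (upd x i t)).
  have h := hg (upd x i 0 + t *: 'e_i).
  by rewrite [upd x i t]upd_line -[dg _]derive_val; exact: is_derive_line.
have [|c] := @MVT_segment R phi _ a b ab (fun t _ => dphi t).
  apply: continuous_subspaceT => t.
  by apply/differentiable_continuous/derivable1_diffP; have [] := dphi t.
rewrite in_itv/= => cab; rewrite /phi -!upd_line => E.
by exists c.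
Qed.

(** Oscillation over one grid step along the i-th axis; it controls every discretisation error
    below. *)
Definition osc_le (M N : nat) i (d : R) g x := forall a b : R,
  `|a| <= M%:R -> `|b| <= M%:R -> `|a - b| <= N%:R^-1 ->
  `|g (upd x i a) - g (upd x i b)| <= d.

(** Uniform continuity on the compact cube. Through this lemma N comes to depend on the function. *)
Lemma near_osc_le (M L : nat) i g (d : R) : (M <= L)%N -> continuous g -> 0 < d ->
  \forall N \near \oo, forall x, cube L x -> osc_le M N i d g x.
Proof.
move=> ML cg d0.
have [r r0 H] := compact_unif_continuous (@compact_cube L) cg d0.
near=> N => x Lx a b aM bM ab; apply/ltW/H => [j|].
  rewrite updE; case: eqVneq => // _.
  by apply: le_trans aM _; rewrite ler_nat.
apply: le_lt_trans (upd_dist _ _ _ _) _; apply: le_lt_trans ab _.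
rewrite -[r]invrK ltf_pV2 ?posrE ?invr_gt0//.
  apply: lt_le_trans (archi_boundP _) _; first by rewrite invr_ge0 ltW.
  by rewrite ler_nat; near: N; exact: nbhs_infty_ge.
by rewrite ltr0n; near: N; exact: nbhs_infty_gt.
Unshelve. all: by end_near. Qed.

Lemma node_itv (M N k : nat) (c : R) : (0 < N)%N -> (k < 2 * M * N)%N ->
  node M N k <= c <= node M N k.+1 ->
  `|c| <= M%:R /\ `|c - node M N k| <= N%:R^-1.
Proof.
move=> N0 kK /andP[kc ck]; split.
  have := @node_bound R M N k (ltnW kK); have := @node_bound R M N _ kK.
  rewrite !ler_norml => /andP[_ h1] /andP[h2 _].
  by rewrite (le_trans h2 kc) (le_trans ck h1).
by rewrite ger0_norm ?subr_ge0// lerBlDl -nodeS.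
Qed.

Lemma node_le (M N k : nat) : (0 < N)%N -> node M N k <= node M N k.+1 :> R.
Proof. by move=> N0; rewrite nodeS// lerDl. Qed.

(** Discrete fundamental theorem of calculus: telescope, apply the mean value theorem in each cell,
    and move the intermediate point to the left node. Each of the 2 M N cells contributes an error d
    / N. *)
Lemma rsum_deriv (M N : nat) i g dg x (d : R) : (0 < N)%N ->
  (forall y, is_derive y 'e_i g (dg y)) -> osc_le M N i d dg x ->
  `|rsum M N i dg x - (g (upd x i M%:R) - g (upd x i (- M%:R)))|
     <= (2 * M)%:R * d.
Proof.
move=> N0 hg osc; set K := (2 * M * N)%N.
have -> : g (upd x i M%:R) - g (upd x i (- M%:R)) =
    \sum_(k < K) (g (upd x i (node M N k.+1)) - g (upd x i (node M N k))).
  rewrite -(big_mkord xpredT (fun k =>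
    g (upd x i (node M N k.+1)) - g (upd x i (node M N k)))).
  by rewrite telescope_sumr// node_last// node0.
rewrite /rsum mulr_sumr -sumrB; apply: le_trans (ler_norm_sum _ _ _) _.
apply: (@le_trans _ _ (\sum_(k < K) N%:R^-1 * d)); last first.
  by have := @rsum_cst R m M N i d x N0; rewrite /rsum mulr_sumr => ->.
apply: ler_sum => k _.
have [c ck ->] := coord_MVT x hg (node_le M k N0).
have [cM cd] := node_itv N0 (ltn_ord k) ck.
rewrite nodeS// [node _ _ _ + _]addrC addrK mulrC -mulrBl normrM mulrC.
rewrite ger0_norm ?invr_ge0// ler_wpM2l ?invr_ge0//.
by apply: osc => //; [exact/node_bound/ltnW|rewrite distrC].
Qed.

(** The points that [rsums M N s] can visit from [x0]: for spatial s, a box at the time of [x0]. *)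
Definition slab (M : nat) (s : seq 'I_m) x0 : set 'rV[R]_m :=
  [set x | forall i, if i \in s then `|x 0 i| <= M%:R else x 0 i == x0 0 i].

Lemma slab_upd M s x0 i y (a : R) : i \in s -> slab M s x0 y -> `|a| <= M%:R ->
  slab M s x0 (upd y i a).
Proof.
move=> iS Sy aM j; have := Sy j; rewrite updE; case: (eqVneq j i) => [->|//].
by rewrite iS.
Qed.

Lemma slab_cube M L s x0 y : (M <= L)%N -> cube L x0 -> slab M s x0 y -> cube L y.
Proof.
move=> ML Lx Sy i; have := Sy i; case: ifP => [_ h|_ /eqP ->//].
by apply: le_trans h _; rewrite ler_nat.
Qed.

Lemma rsums_slab_le M N s (s' : seq 'I_m) x0 G H x : {subset s' <= s} -> slab M s x0 x ->
  (forall y, slab M s x0 y -> G y <= H y) -> rsums M N s' G x <= rsums M N s' H x.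
Proof.
move=> ss Sx GH; apply: (@rsums_le _ _ (slab M s x0)) => // i y a /ss.
exact: slab_upd.
Qed.

Lemma rsums_abs_le M N s (s' : seq 'I_m) x0 G (c : R) x : (0 < N)%N -> {subset s' <= s} ->
  slab M s x0 x -> (forall y, slab M s x0 y -> `|G y| <= c) ->
  `|rsums M N s' G x| <= (2 * M)%:R ^+ size s' * c.
Proof.
move=> N0 ss Sx Gc; rewrite -(@rsums_cst R m M N s' c x N0) ler_norml; apply/andP; split.
  have <- : rsums M N s' (fun=> -1 * c) x = - rsums M N s' (fun=> c) x.
    by rewrite rsumsZ mulN1r.
  apply: (rsums_slab_le _ ss Sx) => y Sy.
  by rewrite mulN1r; have := Gc y Sy; rewrite ler_norml => /andP[].
apply: (rsums_slab_le _ ss Sx) => y /Gc.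
by rewrite ler_norml => /andP[].
Qed.

(** Divergence theorem without boundary terms. The vanishing of g on the faces is asked only on the
    slab of x, because the weight vanishes there only at times of the right sign. *)
Lemma flux_small (M L : nat) (s : seq 'I_m) i g dg (d : R) :
  i \in s -> (M <= L)%N -> (forall y, is_derive y 'e_i g (dg y)) ->
  continuous dg -> 0 < d ->
  \forall N \near \oo, forall x, cube L x -> slab M s x x ->
    (forall y, slab M s x y -> `|y 0 i| = M%:R -> g y = 0) ->
    `|rsums M N s dg x| <= d.
Proof.
move=> iS ML hg cdg d0; set W := (2 * M)%:R ^+ size s : R.
have W0 : 0 <= W by rewrite exprn_ge0.
(* W is the volume of the box and may be 0, hence the + 1. *)
have d1 : 0 < d / (W + 1) by rewrite divr_gt0// ltr_wpDl.
near=> N => x Lx Sx van; have N0 : (0 < N)%N by near: N; exact: nbhs_infty_gt.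
rewrite (@rsums_rem _ _ _ _ _ i)//.
apply: (@le_trans _ _
    ((2 * M)%:R ^+ size (rem i s) * ((2 * M)%:R * (d / (W + 1))))).
  apply: (rsums_abs_le N0 _ Sx) => [j /mem_rem//|y Sy].
  have osc : osc_le M N i (d / (W + 1)) dg y.
    suff: forall z, cube L z -> osc_le M N i (d / (W + 1)) dg z.
      by apply; exact: slab_cube ML Lx Sy.
    by near: N; exact: near_osc_le.
  have v (a : R) : `|a| = M%:R -> g (upd y i a) = 0.
    move=> aM; apply: van; last by rewrite updE eqxx.
    by apply: slab_upd => //; rewrite aM.
  have vM : g (upd y i M%:R) = 0 by apply/v/ger0_norm.
  have vN : g (upd y i (- M%:R)) = 0 by apply: v; rewrite normrN ger0_norm.
  by have := rsum_deriv N0 hg osc; rewrite vM vN !subr0.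
rewrite mulrA -exprSr size_rem// prednK; last by case: (s) iS.
by rewrite -/W mulrCA ger_pMr// ler_pdivrMr ?ltr_wpDl// mul1r lerDl.
Unshelve. all: by end_near. Qed.

Lemma nearest_node (M N : nat) (a : R) : (0 < N)%N -> `|a| <= M%:R ->
  exists2 k, (k <= 2 * M * N)%N & `|a - node M N k| <= N%:R^-1.
Proof.
move=> N0 aM; have N0' : 0 < N%:R :> R by rewrite ltr0n.
move: (aM); rewrite ler_norml => /andP[Ma aM'].
have z0 : 0 <= (a + M%:R) * N%:R by rewrite mulr_ge0// -lerBlDr sub0r.
have /andP[h1 h2] := truncn_itv z0.
exists (Num.truncn ((a + M%:R) * N%:R)).
  rewrite -(ler_nat R); apply: le_trans h1 _; rewrite natrM ler_pM2r//.
  by rewrite mulSn mul1n natrD lerD2r.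
rewrite /node opprB addrA -[X in `|X|]/(a + M%:R - _).
have E : a + M%:R = ((a + M%:R) * N%:R) / N%:R by rewrite mulfK// gt_eqF.
rewrite [X in `|X - _|]E -mulrBl ger0_norm ?divr_ge0 ?subr_ge0//.
rewrite ler_pdivrMr// mulVf ?gt_eqF// lerBlDl -natr1 in h2 *.
by rewrite ltW.
Qed.

(** Along the axis [g ^+ 2] varies by at most the integral of 2 |g dg| <= g^2 + dg^2. Averaging over
    an axis of length 2 M >= 1 bounds the value by this variation plus the integral of g^2, whence
    the factor 2. *)
Lemma sobolev1 (M L : nat) i g dg (d : R) : (0 < M)%N -> (M <= L)%N ->
  (forall y, is_derive y 'e_i g (dg y)) -> continuous g -> continuous dg -> 0 < d ->
  \forall N \near \oo, forall x, cube L x -> `|x 0 i| <= M%:R ->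
    g x ^+ 2 <= 2 * rsum M N i (fun y => g y ^+ 2 + dg y ^+ 2) x + d.
Proof.
move=> M0 ML hg cg cdg d0; pose G y := g y ^+ 2 + dg y ^+ 2.
have cq := continuous_exp2 cg.
have cG : continuous G by apply: continuous_add => //; exact: continuous_exp2.
(* The total error is 2 M e, from the cells, plus 2 e, from moving two points to nodes. *)
pose e : R := d / ((2 * M)%:R + 2); have e0 : 0 < e.
  by rewrite divr_gt0// ltr_wpDl.
near=> N => x Lx xM; have N0 : (0 < N)%N by near: N; exact: nbhs_infty_gt.
have oG : osc_le M N i e G x.
  suff: forall z, cube L z -> osc_le M N i e G z by exact.
  by near: N; exact: near_osc_le.
have oq : osc_le M N i e (fun y => g y ^+ 2) x.
  suff: forall z, cube L z -> osc_le M N i e (fun y => g y ^+ 2) z by exact.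
  by near: N; exact: near_osc_le.
pose q (a : R) := g (upd x i a) ^+ 2.
pose S := rsum M N i G x + (2 * M)%:R * e.
have step k : (k < 2 * M * N)%N -> `|q (node M N k.+1) - q (node M N k)| <=
    N%:R^-1 * (G (upd x i (node M N k)) + e).
  move=> kK.
  have hq y : is_derive y 'e_i (fun y => g y ^+ 2) (2 * g y * dg y).
    have -> : 2 * g y * dg y = dg y * g y + g y * dg y by ring.
    exact: is_derive_mul.
  have [c ck E] := coord_MVT x hq (node_le M k N0).
  have [cM cd] := node_itv N0 kK ck.
  rewrite /q E nodeS// [node _ _ _ + _]addrC addrK normrM mulrC.
  rewrite [X in X * _ <= _]ger0_norm ?invr_ge0// ler_wpM2l ?invr_ge0//.
  apply: (@le_trans _ _ (G (upd x i c))).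
    rewrite /G; set a := g _; set b := dg _.
    rewrite -mulrA normrM (ger0_norm (ler0n R 2)) normrM -(real_normK (num_real a)).
    rewrite -(real_normK (num_real b)) -subr_ge0.
    by have := sqr_ge0 (`|a| - `|b|); lra.
  have := oG c (node M N k) cM (node_bound (ltnW kK)) cd.
  by move=> /ler_normlW; lra.
have G0 y : 0 <= G y by rewrite addr_ge0// sqr_ge0.
have SE : S = \sum_(0 <= k < 2 * M * N) N%:R^-1 * (G (upd x i (node M N k)) + e).
  rewrite big_mkord -mulr_sumr big_split mulrDr /= /S -/(rsum M N i G x).
  by congr (_ + _); rewrite -(@rsum_cst R m M N i e x N0).
have far a b : (a <= b <= 2 * M * N)%N -> `|q (node M N b) - q (node M N a)| <= S.
  move=> /andP[ab bK]; rewrite -(telescope_sumr (fun k => q (node M N k)) ab).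
  apply: le_trans (ler_norm_sum _ _ _) _.
  apply: (@le_trans _ _ (\sum_(a <= k < b) N%:R^-1 * (G (upd x i (node M N k)) + e))).
    rewrite !big_nat; apply: ler_sum => k /andP[_ kb]; apply: step.
    exact: leq_trans bK.
  have t0 k : 0 <= N%:R^-1 * (G (upd x i (node M N k)) + e).
    by rewrite mulr_ge0 ?invr_ge0// addr_ge0// ltW.
  rewrite SE [leRHS](@big_cat_nat _ _ _ a)//= ?(leq_trans ab)//.
  rewrite [X in _ <= _ + X](@big_cat_nat _ _ _ b)//=.
  by rewrite addrCA lerDl addr_ge0// sumr_ge0.
have far' a b : (a <= 2 * M * N)%N -> (b <= 2 * M * N)%N ->
    q (node M N a) <= q (node M N b) + S.
  move=> aK bK; have [ab|/ltnW ba] := leqP a b.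
    by have := far a b; rewrite ab bK => /(_ isT); rewrite distrC => /ler_normlW; lra.
  by have := far b a; rewrite ba aK => /(_ isT) /ler_normlW; lra.
have all (a : R) : `|a| <= M%:R -> g x ^+ 2 <= q a + S + 2 * e.
  move=> aM; rewrite -{1}(upd_self x i) -/(q (x 0 i)).
  have [k kK kx] := nearest_node N0 xM; have [l lK la] := nearest_node N0 aM.
  have h1 := oq _ _ xM (node_bound kK) kx.
  have h2 := oq _ _ aM (node_bound lK) la.
  have := far' _ _ kK lK; move: h1 h2; rewrite -!/(q _).
  by rewrite !ler_norml => /andP[_ h1] /andP[h2 _]; lra.
(* The averaging: the bound [all] is summed over the free point a. *)
have : rsum M N i (fun=> g x ^+ 2 - S - 2 * e) x <= rsum M N i G x.
  apply: (@rsum_le _ _ [set upd x i a | a in [set a : R | `|a| <= M%:R]]).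
    by move=> a aM; exists a.
  move=> _ [a /= aM <-]; have := all a aM; rewrite /q /G.
  by have := sqr_ge0 (dg (upd x i a)); lra.
rewrite rsum_cst// => H.
have M1 : 1 <= (2 * M)%:R :> R by rewrite ler1n muln_gt0.
have Ed : e * ((2 * M)%:R + 2) = d by rewrite /e mulfVK// gt_eqF// ltr_wpDl.
have T0 : 0 <= rsum M N i G x by rewrite mulr_ge0 ?invr_ge0// sumr_ge0.
have [h|h] := leP (g x ^+ 2 - S - 2 * e) 0; first by rewrite /S in h *; nra.
have : g x ^+ 2 - S - 2 * e <= rsum M N i G x.
  by apply: le_trans H; rewrite ler_peMl// ltW.
by rewrite /S; nra.
Unshelve. all: by end_near. Qed.

End GridCalculus.

(** * Iterated derivatives and the Sobolev inequality in several coordinates *)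

Section IteratedDerivatives.
Context {R : realType} {m : nat}.
Implicit Types (g : 'rV[R]_m -> R) (l s : seq 'I_m).

(** Lists of directions replace multi-indices: they suit induction and the separation of time from
    space. [mderiv_pderivs] and [pderivs_mderiv] translate. *)
Definition pderivs l g : 'rV[R]_m -> R := foldr pderiv g l.

Lemma smooth_pderivs l g : smooth g -> smooth (pderivs l g).
Proof. by move=> sg; elim: l => //= i l; exact: smooth_pderiv. Qed.

Lemma pderivs_rcons l i g : pderivs (rcons l i) g = pderivs l (pderiv i g).
Proof. by rewrite /pderivs foldr_rcons. Qed.

Lemma pderivs_cat l l' g : pderivs (l ++ l') g = pderivs l (pderivs l' g).
Proof. by rewrite /pderivs foldr_cat. Qed.

Lemma pderivs_pderiv l i g : smooth g ->
  pderivs l (pderiv i g) = pderiv i (pderivs l g).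
Proof.
move=> sg; elim: l => //= j l ->; rewrite pderivC//; exact: smooth_pderivs.
Qed.

Lemma pderivs_perm l l' g : smooth g -> perm_eq l l' -> pderivs l g = pderivs l' g.
Proof.
move=> sg; elim: l l' => [|i l IH] l' ll'.
  by move: ll'; rewrite perm_sym => /perm_nilP ->.
have il' : i \in l' by rewrite -(perm_mem ll') mem_head.
have [l1 [l2 E]] : exists l1 l2, l' = l1 ++ i :: l2.
  by case/splitPr: il' => l1 l2; exists l1, l2.
rewrite E pderivs_cat /= pderivs_pderiv; last exact: smooth_pderivs.
rewrite -pderivs_cat (IH (l1 ++ l2))//.
by move: ll'; rewrite E -(cat1s i l2) perm_sym perm_catCA /= perm_cons perm_sym.
Qed.

Lemma smooth_is_derive i g x : smooth g -> is_derive x 'e_i g (pderiv i g x).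
Proof. by move=> sg; apply/derivableP; exact: smooth_derivable. Qed.

Lemma smooth_add g h : smooth g -> smooth h -> smooth (g + h).
Proof.
move=> sg sh; rewrite -[h]opprK; apply: smoothB => //.
by rewrite -sub0r; apply: smoothB => //; exact: smooth0.
Qed.

Lemma smooth_sum (I : Type) (r : seq I) (P : pred I) (f : I -> 'rV[R]_m -> R) :
  (forall i, smooth (f i)) -> smooth (\sum_(i <- r | P i) f i).
Proof.
move=> sf; elim/big_ind: _ => //; [exact: smooth0|exact: smooth_add].
Qed.

Lemma pderivsB l g h : smooth g -> smooth h ->
  pderivs l (g - h) = pderivs l g - pderivs l h.
Proof.
move=> sg sh; elim: l => //= i l ->; apply: pderivB; exact: smooth_pderivs.
Qed.

Lemma pderivs0 l : pderivs l (0 : 'rV[R]_m -> R) = 0.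
Proof. by elim: l => //= i l ->; exact: pderiv0. Qed.

Lemma pderivsN l g : smooth g -> pderivs l (- g) = - pderivs l g.
Proof.
by move=> sg; rewrite -sub0r pderivsB ?pderivs0 ?sub0r//; exact: smooth0.
Qed.

Lemma pderivsD l g h : smooth g -> smooth h ->
  pderivs l (g + h) = pderivs l g + pderivs l h.
Proof.
move=> sg sh; have sN : smooth (- h) by rewrite -sub0r; apply: smoothB => //; exact: smooth0.
by rewrite -{1}[h]opprK pderivsB// pderivsN// opprK.
Qed.

Lemma pderivs_sum l (I : Type) (r : seq I) (P : pred I) (f : I -> 'rV[R]_m -> R) :
  (forall i, smooth (f i)) ->
  pderivs l (\sum_(i <- r | P i) f i) = \sum_(i <- r | P i) pderivs l (f i).
Proof.
move=> sf; elim: r => [|i r IH]; first by rewrite !big_nil pderivs0.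
rewrite !big_cons; case: (P i) => //; rewrite pderivsD ?IH//; exact: smooth_sum.
Qed.

Lemma mderiv_pderivs (alpha : 'I_m -> nat) g :
  exists2 l, size l = mdegree alpha & mderiv alpha g = pderivs l g.
Proof.
exists (flatten [seq nseq (alpha i) i | i <- enum 'I_m]).
  rewrite size_flatten /shape -map_comp sumnE big_map /mdegree -big_enum /=.
  by apply: eq_bigr => i _ /=; rewrite size_nseq.
rewrite /mderiv; elim: (enum _) => //= i s ->; rewrite pderivs_cat.
by elim: (alpha i) => //= k ->.
Qed.

Lemma pderivs_mderiv l g : smooth g ->
  exists2 alpha, mdegree alpha = size l & pderivs l g = mderiv alpha g.
Proof.
elim/last_ind: l g => [|l i IH] g sg.
  exists (fun=> 0%N); first by rewrite /mdegree big1.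
  by rewrite /mderiv; elim: (enum _) => //= j s <-.
have [alpha da E] := IH (pderiv i g) (smooth_pderiv i sg).
exists (mincr i alpha); last by rewrite pderivs_rcons E mderiv_pderiv.
rewrite /mdegree /mincr big_split /= -/(mdegree alpha) da size_rcons -addn1.
congr addn; rewrite (bigD1 i)//= eqxx big1 ?addn0// => j /negbTE.
by move=> ->.
Qed.

(** The sum, over all sublists of s, of the squared derivative of g along the sublist: iterating the
    one-dimensional inequality takes at most one derivative per entry of s. *)
Fixpoint sobsum s g : 'rV[R]_m -> R :=
  if s is i :: s' then fun y => sobsum s' g y + sobsum s' (pderiv i g) y
  else fun y => g y ^+ 2.

Lemma sobolev (M L : nat) s g (d : R) : (0 < M)%N -> (M <= L)%N ->
  smooth g -> 0 < d ->
  \forall N \near \oo, forall x, cube L x -> (forall i, i \in s -> `|x 0 i| <= M%:R) ->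
    g x ^+ 2 <= 2 ^+ size s * rsums M N s (sobsum s g) x + d.
Proof.
move=> M0 ML; elim: s g d => [|i s IH] g d sg d0.
  by near=> N => x _ _ /=; rewrite mul1r lerDl ltW.
have M0' : 0 < M%:R :> R by rewrite ltr0n.
(* The errors 2 e, summed over length 2 M and doubled by [sobolev1], make 8 M e = d / 2. *)
pose e : R := d / (16 * M%:R); have e0 : 0 < e by rewrite divr_gt0// mulr_gt0.
have d2 : 0 < d / 2 by rewrite divr_gt0.
near=> N => x Lx xM; have N0 : (0 < N)%N by near: N; exact: nbhs_infty_gt.
have H1 : g x ^+ 2 <= 2 * rsum M N i (fun y => g y ^+ 2 + pderiv i g y ^+ 2) x + d / 2.
  suff H : forall x, cube L x -> `|x 0 i| <= M%:R ->
    g x ^+ 2 <= 2 * rsum M N i (fun y => g y ^+ 2 + pderiv i g y ^+ 2) x + d / 2.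
    by apply: H => //; apply: xM; rewrite mem_head.
  near: N; apply: sobolev1 => //.
  - by move=> y; exact: smooth_is_derive.
  - exact: smooth_cont.
  - by apply/smooth_cont/smooth_pderiv.
have H2 : forall x, cube L x -> (forall i, i \in s -> `|x 0 i| <= M%:R) ->
    g x ^+ 2 <= 2 ^+ size s * rsums M N s (sobsum s g) x + e.
  by near: N; exact: IH.
have H3 : forall x, cube L x -> (forall i, i \in s -> `|x 0 i| <= M%:R) ->
    pderiv i g x ^+ 2 <= 2 ^+ size s * rsums M N s (sobsum s (pderiv i g)) x + e.
  by near: N; apply: IH => //; exact: smooth_pderiv.
apply: le_trans H1 _.
have : rsum M N i (fun y => g y ^+ 2 + pderiv i g y ^+ 2) x <=
    rsum M N i (fun y => 2 ^+ size s * rsums M N s (sobsum (i :: s) g) y + 2 * e) x.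
  apply: (@rsum_le _ _ [set y | cube L y /\
     (forall i, i \in s -> `|y 0 i| <= M%:R)]).
    move=> a aM; split=> j; rewrite updE; case: (eqVneq j i) => // _.
      by apply: le_trans aM _; rewrite ler_nat.
    by move=> js; apply: xM; rewrite inE js orbT.
  move=> y [Ly yM]; rewrite /= rsumsD.
  by have := H2 y Ly yM; have := H3 y Ly yM; lra.
rewrite [X in _ <= X _]rsumD rsumZ rsum_cst// => H.
have Ed : e * (16 * M%:R) = d by rewrite /e mulfVK// gt_eqF// mulr_gt0.
have -> : 2 ^+ size (i :: s) * rsums M N (i :: s) (sobsum (i :: s) g) x =
    2 * (2 ^+ size s * rsum M N i (rsums M N s (sobsum (i :: s) g)) x).
  by rewrite /= exprS mulrA.
rewrite natrM in H; set t := rsum _ _ _ _ _ in H *.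
set u := 2 ^+ size s * _ in H *; lra.
Unshelve. all: by end_near. Qed.

Lemma near_sobsum (M : nat) (D : set 'rV[R]_m) s s' g (c : R) :
  (forall l, (size l <= size s')%N -> \forall N \near \oo, forall x, D x ->
     rsums M N s (fun y => pderivs l g y ^+ 2) x <= c) ->
  \forall N \near \oo, forall x, D x ->
    rsums M N s (sobsum s' g) x <= 2 ^+ size s' * c.
Proof.
elim: s' g => [|i s' IH] g H.
  have := H [::] isT; apply: filterS => N HN x Dx.
  by rewrite mul1r; exact: HN.
near=> N => x Dx; rewrite /= rsumsD exprS -mulrA mulr_natl mulr2n.
apply: lerD.
  suff : forall x, D x -> rsums M N s (sobsum s' g) x <= 2 ^+ size s' * c by apply.
  by near: N; apply: IH => l ls; apply: H; rewrite (leq_trans ls)/=.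
suff : forall x, D x ->
  rsums M N s (sobsum s' (pderiv i g)) x <= 2 ^+ size s' * c by apply.
near: N; apply: IH => l ls; rewrite -pderivs_rcons.
by apply: H; rewrite size_rcons.
Unshelve. all: by end_near. Qed.

End IteratedDerivatives.

(** * Gronwall's lemma in both directions of time *)

Section Gronwall.
Context {R : realType}.
Implicit Types (f df : R -> R).

(** On [0, T] the function [f (sigma * t) * expR (- c * t) - b * t] has nonpositive derivative,
    because [expR (- c * t)] is at most 1. *)
Lemma gronwall f df (sigma c b T : R) : 0 <= b -> 0 <= c -> 0 <= T ->
  (forall t : R, is_derive t 1 f (df t)) ->
  (forall t, 0 <= t <= T -> sigma * df (sigma * t) <= c * f (sigma * t) + b) ->
  f (sigma * T) <= expR (c * T) * (f 0 + b * T).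
Proof.
move=> b0 c0 T0 hf H.
pose g t := f (sigma * t) * expR (- c * t) - b * t.
pose dg t := (sigma * df (sigma * t) - c * f (sigma * t)) * expR (- c * t) - b.
have hl (a t : R) : is_derive t 1 (fun s : R => a * s) a.
  have -> : a = 0 * t + a * 1 by ring.
  by rewrite [in X in is_derive _ _ X](_ : 0 * t + a * 1 = a);
    [exact: (@is_derive_mul _ _ (cst a) id)|ring].
have hg (t : R) : is_derive t 1 g (dg t).
  have h1 : is_derive t 1 (fun s : R => f (sigma * s)) (sigma * df (sigma * t)).
    rewrite mulrC.
    exact: (@is_derive1_comp _ f (fun s => sigma * s)).
  have h2 : is_derive t 1 (fun s : R => expR (- c * s)) (- c * expR (- c * t)).
    by rewrite mulrC; exact: (@is_derive1_comp _ expR (fun s => - c * s)).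
  have h3 := is_derive_mul h1 h2.
  have -> : dg t = sigma * df (sigma * t) * expR (- c * t) +
      f (sigma * t) * (- c * expR (- c * t)) - b by rewrite /dg; ring.
  exact: is_deriveB.
have [|s] := @MVT_segment R g _ 0 T T0 (fun t _ => hg t).
  apply: continuous_subspaceT => t.
  by apply/differentiable_continuous/derivable1_diffP; have [] := hg t.
rewrite in_itv/= subr0 => sT E.
have : g T <= g 0.
  rewrite -subr_le0 E mulr_le0_ge0// /dg subr_le0.
  apply: (@le_trans _ _ (b * expR (- c * s))).
    by rewrite ler_wpM2r ?expR_ge0// lerBlDl H.
  rewrite -[leRHS]mulr1 ler_wpM2l// -[leRHS]expR0 ler_expR mulNr oppr_le0.
  by rewrite mulr_ge0//; case/andP: sT.
rewrite /g !mulr0 expR0 mulr1 subr0 lerBlDr => H'.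
have X : expR (c * T) * expR (- c * T) = 1 by rewrite -expRD mulNr subrr expR0.
rewrite -[leLHS]mulr1 -X mulrCA ler_wpM2l ?expR_ge0//.
Qed.

End Gronwall.

(** * The weight that localises the energy *)

Section Weight.
Context {R : realType} {m : nat} (tau : 'I_m) (sigma : R) (M : nat).
Implicit Types (x y : 'rV[R]_m) (i : 'I_m).

(** This is max (0, s)^2, with derivative 2 max (0, s); the formulas with |s| make continuity
    immediate. *)
Definition sqpos (s : R) : R := s * (s + `|s|) / 2.
Definition dsqpos (s : R) : R := s + `|s|.

Lemma dsqpos_ge0 s : 0 <= dsqpos s.
Proof. by have := ler_norm (- s); rewrite normrN /dsqpos; lra. Qed.

Lemma sqpos_ge0 s : 0 <= sqpos s.
Proof.
rewrite divr_ge0//; have [s0|s0] := leP 0 s.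
  by rewrite mulr_ge0// dsqpos_ge0.
by rewrite ltr0_norm// subrr mulr0.
Qed.

Lemma sqpos_le0 s : s <= 0 -> sqpos s = 0.
Proof. by move=> s0; rewrite /sqpos ler0_norm// subrr mulr0 mul0r. Qed.

Lemma sqposE s : 0 <= s -> sqpos s = s ^+ 2.
Proof. by move=> s0; rewrite /sqpos ger0_norm//; lra. Qed.

(** The derivative [dsqpos] is Lipschitz with constant 2. *)
Lemma sqpos_taylor (a b : R) :
  `|sqpos b - sqpos a - dsqpos a * (b - a)| <= (b - a) ^+ 2.
Proof.
rewrite /dsqpos; have [a0|/ltW a0] := leP 0 a; have [b0|/ltW b0] := leP 0 b.
- rewrite !sqposE// (ger0_norm a0) ler_norml.
  by have S := sqr_ge0 (b - a); apply/andP; split; lra.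
- have ab : 0 <= a * - b by rewrite mulr_ge0// oppr_ge0.
  rewrite [sqpos a]sqposE// sqpos_le0// (ger0_norm a0) ler_norml.
  by have B2 := sqr_ge0 b; have A2 := sqr_ge0 a; apply/andP; split; lra.
- have ab : 0 <= - a * b by rewrite mulr_ge0// oppr_ge0.
  rewrite [sqpos b]sqposE// sqpos_le0// (ler0_norm a0) ler_norml.
  by have B2 := sqr_ge0 b; have A2 := sqr_ge0 a; apply/andP; split; lra.
- rewrite !sqpos_le0// (ler0_norm a0) ler_norml.
  by have S := sqr_ge0 (b - a); apply/andP; split; lra.
Qed.

(* The level sets of [wt] are paraboloids, which for |x_i| <= M shrink faster
   than light. *)
Definition wt y : R :=
  M%:R ^+ 2 - 2 * M%:R * m%:R * sigma * y 0 tau - \sum_(i | i != tau) y 0 i ^+ 2.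

Definition dwt i y : R :=
  if i == tau then - (2 * M%:R * m%:R * sigma) else - (2 * y 0 i).

Definition weight y : R := sqpos (wt y).
Definition dweight i y : R := dsqpos (wt y) * dwt i y.

(** The remainder is exactly 0 in the time direction, where [wt] is affine, and - h^2 in a spatial
    one. *)
Lemma wt_line i y (h : R) : `|wt (y + h *: 'e_i) - wt y - h * dwt i y| <= h ^+ 2.
Proof.
have E j : (y + h *: 'e_i) 0 j = y 0 j + h * (j == i)%:R by rewrite !mxE eqxx.
rewrite /wt /dwt E eq_sym; have [->|it] := eqVneq tau i.
  rewrite (eq_bigr (fun j => y 0 j ^+ 2)); last first.
    by move=> j /negbTE ji; rewrite E ji mulr0 addr0.
  rewrite [X in `|X|](_ : _ = 0) ?normr0 ?sqr_ge0//.
  by rewrite mulr1; ring.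
have Ei (z : 'rV[R]_m) : \sum_(j | j != tau) z 0 j ^+ 2 =
    z 0 i ^+ 2 + \sum_(j | (j != tau) && (j != i)) z 0 j ^+ 2.
  by rewrite (bigD1 i)//= eq_sym.
rewrite !Ei E eqxx.
rewrite (eq_bigr (fun j => y 0 j ^+ 2)); last first.
  by move=> j /andP[_ /negbTE ji]; rewrite E ji mulr0 addr0.
rewrite [X in `|X|](_ : _ = - h ^+ 2); last by rewrite /=; ring.
by rewrite normrN ger0_norm ?sqr_ge0.
Qed.

Lemma is_derive_weight i y : is_derive y 'e_i weight (dweight i y).
Proof.
(* The first term comes from [sqpos_taylor], as [wt] moves by at most |h| (|dwt| + 1) for |h| <= 1;
   the second from the remainder of [wt]. *)
apply: (@is_derive_quadratic_error _ _ _ _ _ _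
  ((`|dwt i y| + 1) ^+ 2 + dsqpos (wt y))) => h h1.
have H := wt_line i y h; set l := dwt i y in H *.
set a := wt y in H *; set b := wt _ in H *.
have T := sqpos_taylor a b; have D0 := dsqpos_ge0 a.
have B : `|b - a| <= `|h| * (`|l| + 1).
  rewrite -(subrK (h * l) (b - a)); apply: le_trans (ler_normD _ _) _.
  rewrite normrM mulrDr mulr1 addrC lerD2l; apply: le_trans H _.
  by rewrite -real_normK ?num_real// expr2 ler_piMr.
rewrite /weight /dweight -/a -/b -/l.
rewrite (_ : _ - _ = sqpos b - sqpos a - dsqpos a * (b - a)
  + dsqpos a * (b - a - h * l)); last by ring.
apply: le_trans (ler_normD _ _) _; rewrite [leRHS]mulrDl lerD//.
  apply: le_trans T _; rewrite -[(b - a) ^+ 2]real_normK ?num_real//.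
  rewrite -[h ^+ 2]real_normK ?num_real// -exprMn mulrC.
  by rewrite lerXn2r ?nnegrE ?mulr_ge0 ?addr_ge0.
by rewrite normrM ger0_norm// ler_wpM2l.
Qed.

Lemma continuous_coord i : continuous (fun y : 'rV[R]_m => y 0 i).
Proof. by move=> y; exact: coord_continuous. Qed.

Lemma continuous_wt : continuous wt.
Proof.
have -> : wt = (fun y => (M%:R ^+ 2 + - (2 * M%:R * m%:R * sigma) * y 0 tau) +
   -1 * \sum_(i | i != tau) y 0 i ^+ 2).
  by apply/funext => y; rewrite /wt; ring.
apply: continuous_add.
  apply: continuous_add; first exact: continuous_cst.
  by apply: continuous_mul; [exact: continuous_cst|exact: continuous_coord].
apply: continuous_mul; first exact: continuous_cst.
by apply: continuous_bigsum => i; apply: continuous_exp2; exact: continuous_coord.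
Qed.

Lemma continuous_dsqpos : continuous (fun y => dsqpos (wt y)).
Proof.
apply: continuous_add; first exact: continuous_wt.
by move=> y; exact: (cvg_norm (@continuous_wt y)).
Qed.

Lemma continuous_weight : continuous weight.
Proof.
apply: continuous_mul; last exact: continuous_cst.
by apply: continuous_mul; [exact: continuous_wt|exact: continuous_dsqpos].
Qed.

Lemma continuous_dweight i : continuous (dweight i).
Proof.
apply: continuous_mul; first exact: continuous_dsqpos.
rewrite /dwt; case: (i == tau); first exact: continuous_cst.
have -> : (fun y : 'rV[R]_m => - (2 * y 0 i)) = (fun y => - 2 * y 0 i).
  by apply/funext => y; rewrite mulNr.
by apply: continuous_mul; [exact: continuous_cst|exact: continuous_coord].
Qed.

Lemma weight_ge0 y : 0 <= weight y. Proof. exact: sqpos_ge0. Qed.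

Lemma wt_le y : 0 <= sigma * y 0 tau -> wt y <= M%:R ^+ 2.
Proof.
move=> s0; rewrite /wt -addrA gerDl -opprD oppr_le0 addr_ge0//.
  by rewrite -[_ * sigma * _]mulrA mulr_ge0.
by apply: sumr_ge0 => i _; exact: sqr_ge0.
Qed.

Lemma weight_le y : 0 <= sigma * y 0 tau -> weight y <= M%:R ^+ 4.
Proof.
move=> /wt_le s0; rewrite /weight; have [w0|/ltW w0] := leP 0 (wt y).
  by rewrite sqposE// (exprM _ 2 2) lerXn2r ?nnegrE ?exprn_ge0.
by rewrite sqpos_le0// exprn_ge0.
Qed.

(** On a lateral face the square of one coordinate already cancels M^2, so the fluxes through it
    vanish. *)
Lemma weight_eq0 y i : i != tau -> 0 <= sigma * y 0 tau -> `|y 0 i| = M%:R ->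
  weight y = 0.
Proof.
move=> it s0 yM; apply: sqpos_le0; rewrite /wt (bigD1 i)//=.
rewrite -[y 0 i ^+ 2]real_normK ?num_real// yM.
have X0 : 0 <= 2 * M%:R * m%:R * (sigma * y 0 tau) by rewrite mulr_ge0.
set S := \sum_(_ | _) _; have S0 : 0 <= S.
  by apply: sumr_ge0 => j _; exact: sqr_ge0.
lra.
Qed.

End Weight.

(** * The weighted energy identity *)

Section EnergyEstimate.
Context {R : realType} {m : nat} (tau : 'I_m).
Implicit Types (v : 'rV[R]_m -> R) (x y : 'rV[R]_m) (i : 'I_m).

Definition space : seq 'I_m := [seq i <- enum 'I_m | i != tau].

Lemma mem_space i : (i \in space) = (i != tau).
Proof. by rewrite mem_filter mem_enum andbT. Qed.

Definition wave_op v : 'rV[R]_m -> R :=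
  pderiv tau (pderiv tau v) - \sum_(i | i != tau) pderiv i (pderiv i v).

Lemma wave_opE v y : wave_op v y =
  pderiv tau (pderiv tau v) y - \sum_(i | i != tau) pderiv i (pderiv i v) y.
Proof. by rewrite /wave_op !fctE fct_sumE. Qed.

Lemma smooth_wave_op v : smooth v -> smooth (wave_op v).
Proof.
move=> sv; apply: smoothB; first by do 2 apply: smooth_pderiv.
by apply: smooth_sum => i; do 2 apply: smooth_pderiv.
Qed.

Lemma pderivs_wave_op l v : smooth v ->
  pderivs l (wave_op v) = wave_op (pderivs l v).
Proof.
move=> sv; have s2 i : smooth (pderiv i (pderiv i v)) by do 2 apply: smooth_pderiv.
have E i : pderivs l (pderiv i (pderiv i v)) = pderiv i (pderiv i (pderivs l v)).
  by rewrite !pderivs_pderiv//; exact: smooth_pderiv.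
rewrite /wave_op pderivsB//; last exact: smooth_sum.
rewrite E pderivs_sum//; congr (_ - _); exact: eq_bigr.
Qed.

Lemma rsums_bigsum M N s (I : Type) (r : seq I) (P : pred I)
    (f : I -> 'rV[R]_m -> R) x :
  rsums M N s (fun y => \sum_(j <- r | P j) f j y) x =
  \sum_(j <- r | P j) rsums M N s (f j) x.
Proof.
elim: r => [|j r IH].
  rewrite big_nil [X in rsums _ _ _ X](_ : _ = fun y => 0 * 0).
    by rewrite rsumsZ mul0r.
  by apply/funext => y; rewrite big_nil mul0r.
rewrite big_cons -IH; case: (boolP (P j)) => Pj.
  rewrite -[RHS]/((fun y => _) x) -rsumsD; congr rsums.
  by apply/funext => y; rewrite big_cons Pj.
by congr rsums; apply/funext => y; rewrite big_cons (negbTE Pj).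
Qed.

(** The sum includes i = tau. The term v^2 gives control of v, at the price of 2 v d_t v in the time
    derivative. *)
Definition edens v y : R := v y ^+ 2 + \sum_i pderiv i v y ^+ 2.
Definition dedens v y : R := 2 * (v y * pderiv tau v y) +
  \sum_i 2 * (pderiv i v y * pderiv tau (pderiv i v) y).

Lemma edens_ge0 v y : 0 <= edens v y.
Proof. by rewrite addr_ge0 ?sqr_ge0// sumr_ge0// => i _; exact: sqr_ge0. Qed.

Lemma sqr_le_edens v y : v y ^+ 2 <= edens v y.
Proof. by rewrite lerDl sumr_ge0// => i _; exact: sqr_ge0. Qed.

Lemma is_derive_sqr (g : 'rV[R]_m -> R) (dg : R) y u :
  is_derive y u g dg -> is_derive y u (fun y => g y ^+ 2) (2 * (g y * dg)).
Proof.
move=> h; have -> : 2 * (g y * dg) = dg * g y + g y * dg by ring.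
exact: is_derive_mul.
Qed.

Lemma is_derive_edens v y : smooth v ->
  is_derive y 'e_tau (edens v) (dedens v y).
Proof.
move=> sv; apply: is_derive_add; first exact/is_derive_sqr/smooth_is_derive.
apply: is_derive_bigsum => i _; apply/is_derive_sqr/smooth_is_derive.
exact: smooth_pderiv.
Qed.

Section Weighted.
Context (sigma : R) (M : nat) (sigma2 : sigma ^+ 2 = 1).
Local Notation phi := (weight tau sigma M).
Local Notation dphi := (dweight tau sigma M).
Local Notation wt := (wt tau sigma M).

Let nsigma : `|sigma| = 1.
Proof.
by apply/eqP; rewrite -(@eqrXn2 _ 2)// expr1n real_normK ?num_real ?sigma2.
Qed.

(** Subtracting the divergence of this energy flux turns the mixed terms 2 v_i v_it into - 2 v_t
    v_ii, which complete [wave_op]. *)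
Definition flux i v y : R := phi y * (2 * (pderiv tau v y * pderiv i v y)).
Definition dflux i v y : R := dphi i y * (2 * (pderiv tau v y * pderiv i v y)) +
  phi y * (2 * (pderiv i (pderiv tau v) y * pderiv i v y +
                pderiv tau v y * pderiv i (pderiv i v) y)).

Lemma is_derive_flux i v y : smooth v ->
  is_derive y 'e_i (flux i v) (dflux i v y).
Proof.
move=> sv; apply: is_derive_mul; first exact: is_derive_weight.
rewrite -[2 * (_ + _)]add0r -{1}(mul0r (pderiv tau v y * pderiv i v y)).
apply: (@is_derive_mul _ _ (cst 2)); apply: is_derive_mul;
  by apply: smooth_is_derive; exact: smooth_pderiv.
Qed.

Lemma continuous_pderiv i v : smooth v -> continuous (pderiv i v).
Proof. by move=> sv; apply/smooth_cont/smooth_pderiv. Qed.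

Lemma continuous_dflux i v : smooth v -> continuous (dflux i v).
Proof.
move=> sv; have c1 j := @continuous_pderiv j v sv.
have c2 j k : continuous (pderiv j (pderiv k v)).
  by apply: continuous_pderiv; exact: smooth_pderiv.
have c0 := @continuous_cst R m 2.
apply: continuous_add; apply: continuous_mul; [exact: continuous_dweight| |
  exact: continuous_weight|]; apply: continuous_mul => //.
  exact: continuous_mul.
by apply: continuous_add; exact: continuous_mul.
Qed.

(** After the mixed derivatives cancel, the slopes of the weight leave a nonpositive term, and the
    inequality 2 a b <= a^2 + b^2 bounds 2 v v_t + 2 v_t [wave_op v], up to sign, by twice the
    density plus the squared source. *)
Lemma energy_density_growth v y : smooth v ->
  (forall i, i != tau -> `|y 0 i| <= M%:R) ->
  sigma * (dphi tau y * edens v y + phi y * dedens v y) -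
    \sum_(i | i != tau) sigma * dflux i v y <=
  2 * (phi y * edens v y) + phi y * wave_op v y ^+ 2.
Proof.
move=> sv yM; set e := edens v y; set vt := pderiv tau v y.
set p := phi y; set q := dsqpos (wt y).
pose S1 := \sum_(i | i != tau) 2 * (pderiv i v y * pderiv tau (pderiv i v) y).
pose S2 := \sum_(i | i != tau) pderiv i (pderiv i v) y.
pose S3 := \sum_(i | i != tau) dphi i y * (2 * (vt * pderiv i v y)).
have p0 : 0 <= p by exact: weight_ge0.
have q0 : 0 <= q by exact: dsqpos_ge0.
have e0 : 0 <= e by exact: edens_ge0.
have e1 : v y ^+ 2 + vt ^+ 2 <= e.
  rewrite /e /edens (bigD1 tau)//= addrA lerDl sumr_ge0// => i _.
  exact: sqr_ge0.
have e2 i : i != tau -> vt ^+ 2 + pderiv i v y ^+ 2 <= e.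
  move=> it; rewrite /e /edens (bigD1 tau)//= (bigD1 i)//= -/vt.
  set r := \sum_(_ | _) _; have r0 : 0 <= r.
    by apply: sumr_ge0 => j _; exact: sqr_ge0.
  by have := sqr_ge0 (v y); lra.
have E1 : dedens v y = 2 * (v y * vt) + (2 * (vt * pderiv tau (pderiv tau v) y) + S1).
  by rewrite /dedens (bigD1 tau).
have E2 : \sum_(i | i != tau) sigma * dflux i v y =
    sigma * S3 + (sigma * p * S1 + sigma * p * (2 * vt) * S2).
  have alg (s a b t u w z : R) : s * (a * (2 * (t * u)) + b * (2 * (w * u + t * z)))
    = s * (a * (2 * (t * u))) + (s * b * (2 * (u * w)) + s * b * (2 * t) * z).
    by ring.
  rewrite !mulr_sumr -!big_split; apply: eq_bigr => i it /=.
  by rewrite [pderiv tau (pderiv i v)]pderivC//; exact: alg.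
(* Each spatial direction costs at most 2 M q e, by |y_i| <= M and 2 |v_t v_i| <= e. *)
have E3 : - (sigma * S3) <= 2 * M%:R * m%:R * q * e.
  apply: (@le_trans _ _ (\sum_(i | i != tau) 2 * M%:R * q * e)).
    rewrite mulr_sumr -sumrN; apply: ler_sum => i it.
    apply: le_trans (ler_norm _) _; rewrite normrN normrM nsigma mul1r normrM.
    apply: ler_pM => //; last first.
      apply: le_trans (e2 i it); have := sqr_ge0 (vt - pderiv i v y).
      have := sqr_ge0 (vt + pderiv i v y).
      by rewrite ler_norml => h1 h2; apply/andP; split; lra.
    rewrite normrM ger0_norm// -/q mulrC ler_wpM2r// /dwt (negbTE it).
    by rewrite normrN normrM ger0_norm// ler_wpM2l// yM.
  rewrite [leRHS](_ : _ = \sum_(i < m) 2 * M%:R * q * e); last first.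
    by rewrite sumr_const card_ord -mulr_natl; ring.
  rewrite [leRHS](bigD1 tau)//= lerDr.
  by rewrite !mulr_ge0.
have E4 : dphi tau y = q * - (2 * M%:R * m%:R * sigma).
  by rewrite /dweight /dwt eqxx.
rewrite E1 E2 E4 wave_opE -/S2; set vtt := pderiv tau (pderiv tau v) y.
have F1 : 2 * (sigma * (v y * vt)) <= v y ^+ 2 + vt ^+ 2.
  have := sqr_ge0 (v y - sigma * vt); rewrite sqrrB exprMn sigma2 mul1r.
  by rewrite -mulr_natl; lra.
have F2 : 2 * (sigma * (vt * (vtt - S2))) <= vt ^+ 2 + (vtt - S2) ^+ 2.
  have := sqr_ge0 (vtt - S2 - sigma * vt); rewrite sqrrB exprMn sigma2 mul1r.
  by rewrite -mulr_natl; lra.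
have F3 : p * (2 * (sigma * (v y * vt)) + 2 * (sigma * (vt * (vtt - S2)))) <=
    p * (2 * e + (vtt - S2) ^+ 2).
  by rewrite ler_wpM2l//; have := sqr_ge0 (v y); lra.
(* The time slope of the weight was chosen to cancel the bound of [E3]. *)
have F4 : sigma * (q * - (2 * M%:R * m%:R * sigma)) = - (2 * M%:R * m%:R * q).
  by rewrite mulrN mulrN; congr (- _); rewrite -[RHS]mulr1 -sigma2; ring.
rewrite mulrDr mulrA F4; lra.
Qed.

Lemma energy_growth (L : nat) v (d : R) : (M <= L)%N -> smooth v -> 0 < d ->
  \forall N \near \oo, forall y, cube L y ->
    (forall i, i != tau -> `|y 0 i| <= M%:R) -> 0 <= sigma * y 0 tau ->
    sigma * rsums M N space (fun z => dphi tau z * edens v z + phi z * dedens v z) y <=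
    2 * rsums M N space (fun z => phi z * edens v z) y +
    rsums M N space (fun z => phi z * wave_op v z ^+ 2) y + d.
Proof.
(* Shared among the spatial fluxes, of which there are fewer than m + 1. *)
move=> ML sv d0; pose e : R := d / m.+1%:R.
have e0 : 0 < e by rewrite divr_gt0.
near=> N => y Ly yM sy.
have H i : i != tau -> `|rsums M N space (dflux i v) y| <= e.
  move=> it; have Sy : slab M space y y.
    by move=> j; rewrite mem_space; case: ifP => // /yM.
  suff : forall i, i != tau -> forall x, cube L x -> slab M space x x ->
      (forall y, slab M space x y -> `|y 0 i| = M%:R -> flux i v y = 0) ->
      `|rsums M N space (dflux i v) x| <= e.
    (* The slab of y stays at the time of y, whose sign is the one that [weight_eq0] needs. *)
    apply=> // z Sz zi; rewrite /flux (weight_eq0 it _ zi) ?mul0r//.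
    have := Sz tau; rewrite mem_space eqxx /= => /eqP ->.
    exact: sy.
  near: N; apply: filter_forall => j.
  have [->|jt] := eqVneq j tau; first by near=> N.
  have := @flux_small R m M L space j (flux j v) (dflux j v) e.
  rewrite mem_space => /(_ jt ML (fun y => is_derive_flux j y sv)
    (continuous_dflux sv) e0).
  by apply: filterS => N h _; exact: h.
set D := fun z => dphi tau z * edens v z + phi z * dedens v z.
have E : sigma * rsums M N space D y =
    rsums M N space (fun z => sigma * D z - \sum_(i | i != tau) sigma * dflux i v z) y
    + \sum_(i | i != tau) sigma * rsums M N space (dflux i v) y.
  rewrite (_ : (fun z => _ - _) = (fun z => sigma * D z +
     \sum_(i | i != tau) - sigma * dflux i v z)); last first.
    apply/funext => z; congr (_ + _); rewrite -sumrN.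
    by apply: eq_bigr => i _; rewrite mulNr.
  rewrite [in RHS]rsumsD [in RHS]rsumsZ rsums_bigsum -addrA -big_split/= big1 ?addr0// => i _.
  by rewrite rsumsZ mulNr addNr.
rewrite E; apply: lerD.
  have X (F G : 'rV[R]_m -> R) : 2 * rsums M N space F y + rsums M N space G y =
      rsums M N space (fun z => 2 * F z + G z) y by rewrite rsumsD rsumsZ.
  rewrite X.
  apply: (@rsums_le _ _ [set z | forall i, i != tau -> `|z 0 i| <= M%:R]) => //.
    move=> i z a _ zM aM j jt; rewrite updE; case: eqVneq => // _.
    exact: zM.
  by move=> z zM; exact: energy_density_growth.
apply: (@le_trans _ _ (\sum_(i < m) e)).
  rewrite [leRHS](bigID (fun i => i != tau))/= -[leLHS]addr0 lerD//.
    apply: ler_sum => i it; apply: le_trans (ler_norm _) _.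
    by rewrite normrM nsigma mul1r H.
  by rewrite sumr_ge0// => i _; exact: ltW.
rewrite sumr_const card_ord -mulr_natr /e mulrAC ler_pdivrMr//.
by rewrite ler_pM2l// ler_nat.
Unshelve. all: by end_near. Qed.

Lemma is_derive_energy N v x (t : R) : smooth v ->
  is_derive t 1 (fun s : R => rsums M N space (fun z => phi z * edens v z) (upd x tau s))
   (rsums M N space (fun z => dphi tau z * edens v z + phi z * dedens v z)
     (upd x tau t)).
Proof.
move=> sv; set E := rsums M N space (fun z => phi z * edens v z).
have dE y : is_derive y 'e_tau E
   (rsums M N space (fun z => dphi tau z * edens v z + phi z * dedens v z) y).
  apply: is_derive_rsums; first by rewrite mem_space eqxx.
  move=> z; apply: is_derive_mul; first exact: is_derive_weight.
  exact: is_derive_edens.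
rewrite -[X in is_derive _ _ _ X](@derive_val _ _ _ _ _ _ _ (dE (upd x tau t))).
rewrite (_ : (fun s => _) = (fun s => E (upd x tau 0 + s *: 'e_tau))); last first.
  by apply/funext => s; rewrite -upd_line.
by rewrite [upd x tau t]upd_line; apply: is_derive_line; rewrite -upd_line.
Qed.

End Weighted.

End EnergyEstimate.

(** * The local energy estimate *)

Section WaveEstimate.
Context {R : realType} {m : nat} (tau : 'I_m).
Implicit Types (v w : 'rV[R]_m -> R) (x y : 'rV[R]_m) (i : 'I_m) (l : seq 'I_m).
Local Notation space := (space tau).
Local Notation wave_op := (wave_op tau).

(** On this region [wt] is at least M (M - 2 m T) - m T^2 = M (m T^2 + 1) - m T^2, which is at least
    1 since M >= 1. *)
Lemma weight_ge1 (T M : nat) (sigma : R) y :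
  M = (2 * m * T + m * T ^ 2 + 1)%N -> 0 <= sigma * y 0 tau <= T%:R ->
  (forall i, i != tau -> `|y 0 i| <= T%:R) -> 1 <= weight tau sigma M y.
Proof.
move=> ME /andP[s0 sT] yT; set r : R := M%:R.
have rE : r = 2 * m%:R * T%:R + m%:R * T%:R ^+ 2 + 1.
  by rewrite /r ME !natrD natrM natrM natrM natrX.
have S : \sum_(i | i != tau) y 0 i ^+ 2 <= m%:R * T%:R ^+ 2.
  apply: (@le_trans _ _ (\sum_(i | i != tau) T%:R ^+ 2)).
    apply: ler_sum => i it; rewrite -[leLHS]real_normK ?num_real//.
    by rewrite lerXn2r ?nnegrE// yT.
  rewrite [leRHS](_ : _ = \sum_(i < m) T%:R ^+ 2); last first.
    by rewrite sumr_const card_ord mulr_natl.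
  by rewrite [leRHS](bigD1 tau)//= lerDr sqr_ge0.
have w1 : 1 <= wt tau sigma M y.
  rewrite /wt -/r.
  have h1 : 2 * r * m%:R * (sigma * y 0 tau) <= 2 * r * m%:R * T%:R.
    by rewrite ler_wpM2l// !mulr_ge0.
  have h2 : r ^+ 2 - 2 * r * m%:R * T%:R = r * (m%:R * T%:R ^+ 2 + 1).
    have -> : m%:R * T%:R ^+ 2 + 1 = r - 2 * m%:R * T%:R by rewrite rE; ring.
    by ring.
  have r1 : 1 <= r by rewrite ler1n ME addn1.
  have a0 : 0 <= m%:R * T%:R ^+ 2 + 1 :> R by rewrite addr_ge0// mulr_ge0.
  have h3 : m%:R * T%:R ^+ 2 + 1 <= r * (m%:R * T%:R ^+ 2 + 1).
    by rewrite ler_peMl.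
  by lra.
by rewrite /weight sqposE ?exprn_ege1// (le_trans _ w1).
Qed.

Lemma energy_bound (T : nat) : exists M C, [/\ 0 <= C, (T <= M)%N &
  forall v (B d : R), smooth v -> 0 <= B -> 0 < d ->
  (forall y, cube M y -> y 0 tau = 0 -> `|v y| <= B /\ forall i, `|pderiv i v y| <= B) ->
  (forall y, cube M y -> `|wave_op v y| <= B) ->
  \forall N \near \oo, forall x, cube T x ->
    rsums T N space (fun z => v z ^+ 2) x <= C * B ^+ 2 + d].
Proof.
pose M := (2 * m * T + m * T ^ 2 + 1)%N; exists M.
have TM : (T <= M)%N.
  have m0 : (0 < m)%N by apply: leq_ltn_trans (ltn_ord tau).
  rewrite /M -addnA (leq_trans _ (leq_addr _ _))// -[leqLHS]mul1n leq_mul2r.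
  by rewrite muln_gt0 m0 orbT.
(* The volume of the spatial box times the bound of [weight_le]. *)
set W : R := (2 * M)%:R ^+ size space * M%:R ^+ 4.
have W0 : 0 <= W by rewrite mulr_ge0 ?exprn_ge0.
(* Gronwall at rate 2 up to time T: the initial energy is at most W (m + 1) B^2, the source W B^2
   per unit of time. *)
exists (expR (2 * T%:R) * (W * (m%:R + 1) + W * T%:R)); split=> //.
  by rewrite mulr_ge0 ?expR_ge0// addr_ge0// mulr_ge0// addr_ge0.
move=> v B d sv B0 d0 H0 H1.
pose e : R := d / (expR (2 * T%:R) * (T%:R + 1)).
have X0 : 0 < expR (2 * T%:R) * (T%:R + 1) :> R.
  by rewrite mulr_gt0 ?expR_gt0// ltr_wpDl.
have e0 : 0 < e by rewrite divr_gt0.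
have s1 : (1 : R) ^+ 2 = 1 by rewrite expr1n.
have s2 : (-1 : R) ^+ 2 = 1 by rewrite sqrrN expr1n.
near=> N => x Tx; have N0 : (0 < N)%N by near: N; exact: nbhs_infty_gt.
pose P (sigma : R) := forall y, cube M y ->
    (forall i, i != tau -> `|y 0 i| <= M%:R) -> 0 <= sigma * y 0 tau ->
    sigma * rsums M N space (fun z => dweight tau sigma M tau z * edens v z +
       weight tau sigma M z * dedens tau v z) y <=
    2 * rsums M N space (fun z => weight tau sigma M z * edens v z) y +
    rsums M N space (fun z => weight tau sigma M z * wave_op v z ^+ 2) y + e.
(* The sign of the time of x, so that Gronwall runs from time 0 towards x. *)
have [sigma [ss st Ps]] : exists sigma : R,
    [/\ sigma ^+ 2 = 1, sigma * x 0 tau = `|x 0 tau| & P sigma].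
  have [t0|t0] := leP 0 (x 0 tau).
    exists 1; split=> //; first by rewrite mul1r ger0_norm.
    by rewrite /P; near: N; exact: (energy_growth tau s1 (leqnn M) sv e0).
  exists (-1); split=> //; first by rewrite mulN1r ltr0_norm.
  by rewrite /P; near: N; exact: (energy_growth tau s2 (leqnn M) sv e0).
have Tt : `|x 0 tau| <= T%:R by exact: Tx.
have TMr : T%:R <= M%:R :> R by rewrite ler_nat.
set f := fun s : R => rsums M N space
  (fun z => weight tau sigma M z * edens v z) (upd x tau s).
have cubeu (s : R) : `|s| <= T%:R -> cube M (upd x tau s).
  move=> sT i; rewrite updE; case: (eqVneq i tau) => // _; last exact: le_trans (Tx i) _.
  exact: le_trans sT _.
have slabu (s : R) : slab M space (upd x tau s) (upd x tau s).
  move=> i; rewrite mem_space; case: ifP => // it; rewrite updE.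
  by rewrite (negbTE it); apply: le_trans (Tx i) _.
have slabt (s : R) z : slab M space (upd x tau s) z -> z 0 tau = s.
  by move/(_ tau); rewrite mem_space eqxx /= updE eqxx => /eqP.
have sumle (s c : R) (G : 'rV[R]_m -> R) : `|s| <= T%:R -> 0 <= sigma * s ->
    (forall z, cube M z -> z 0 tau = s -> 0 <= G z <= c) ->
    rsums M N space (fun z => weight tau sigma M z * G z) (upd x tau s) <= W * c.
  move=> sT s0 Gc; rewrite /W -mulrA; apply: le_trans (ler_norm _) _.
  apply: (@rsums_abs_le _ _ _ _ space space (upd x tau s)) => // z Sz.
  have zs := slabt _ _ Sz.
  have /andP[G0 G1] := Gc z (slab_cube (leqnn M) (cubeu s sT) Sz) zs.
  have p0 := weight_ge0 tau sigma M z; rewrite (ger0_norm (mulr_ge0 p0 G0)).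
  by apply: ler_pM => //; apply: weight_le; rewrite zs.
have f0 : f 0 <= W * ((m%:R + 1) * B ^+ 2).
  apply: sumle; rewrite ?normr0 ?mulr0// => z Mz zt.
  rewrite edens_ge0 /=; have [h1 h2] := H0 z Mz zt.
  have sq (a : R) : `|a| <= B -> a ^+ 2 <= B ^+ 2.
    by move=> aB; rewrite -[leLHS]real_normK ?num_real// lerXn2r ?nnegrE.
  rewrite /edens mulrDl mul1r addrC lerD ?sq//.
  rewrite -[m in leRHS]card_ord mulr_natl -sumr_const.
  by apply: ler_sum => i _; exact: sq.
have G : f (sigma * `|x 0 tau|) <=
    expR (2 * `|x 0 tau|) * (f 0 + (W * B ^+ 2 + e) * `|x 0 tau|).
  apply: (@gronwall _ f (fun s => rsums M N space
     (fun z => dweight tau sigma M tau z * edens v z +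
       weight tau sigma M z * dedens tau v z) (upd x tau s))) => //.
  - by rewrite addr_ge0 ?(ltW e0)// mulr_ge0// sqr_ge0.
  - by move=> t; exact: is_derive_energy.
  move=> t /andP[t0 tx].
  have sst : sigma * (sigma * t) = t by rewrite mulrA -expr2 ss mul1r.
  have nst : `|sigma * t| <= T%:R.
    have : `|sigma * t| ^+ 2 = `|t| ^+ 2.
      by rewrite !real_normK ?num_real// exprMn ss mul1r.
    move/eqP; rewrite eqrXn2// => /eqP ->; rewrite ger0_norm//.
    exact: le_trans tx Tt.
  have sumF := @sumle (sigma * t) (B ^+ 2) (fun z => wave_op v z ^+ 2) nst.
  have growth := Ps (upd x tau (sigma * t)) (cubeu _ nst).
  apply: le_trans (growth _ _) _.
  - by move=> i it; have := slabu (sigma * t) i; rewrite mem_space it.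
  - by rewrite updE eqxx sst.
  rewrite -addrA lerD2l lerD2r; apply: sumF; first by rewrite sst.
  move=> z Mz _; rewrite sqr_ge0/= -[leLHS]real_normK ?num_real//.
  by rewrite lerXn2r ?nnegrE// H1.
have xE : sigma * `|x 0 tau| = x 0 tau by rewrite -st mulrA -expr2 ss mul1r.
rewrite xE /f upd_self in G.
have le1 : rsums T N space (fun z => v z ^+ 2) x <=
    rsums T N space (fun z => weight tau sigma M z * edens v z) x.
  apply: (@rsums_slab_le _ _ _ _ space _ x) => //.
    by move=> i; rewrite mem_space; case: ifP => // _; exact: Tx.
  move=> z Sz; apply: le_trans (sqr_le_edens v z) _.
  rewrite ler_peMl ?edens_ge0//; apply: (@weight_ge1 T) => //.
    have := Sz tau; rewrite mem_space eqxx /= => /eqP ->.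
    by rewrite st normr_ge0.
  by move=> i it; have := Sz i; rewrite mem_space it.
apply: le_trans le1 _; apply: le_trans (rsums_mono _ _ _ TM _) _.
  by move=> z; rewrite mulr_ge0 ?weight_ge0 ?edens_ge0.
apply: le_trans G _.
have A0 : 0 <= W * ((m%:R + 1) * B ^+ 2) + (W * B ^+ 2 + e) * T%:R.
  rewrite addr_ge0// mulr_ge0// ?addr_ge0 ?mulr_ge0 ?addr_ge0 ?sqr_ge0//.
  exact: ltW.
apply: (@le_trans _ _ (expR (2 * T%:R) *
   (W * ((m%:R + 1) * B ^+ 2) + (W * B ^+ 2 + e) * T%:R))).
  apply: (@le_trans _ _ (expR (2 * `|x 0 tau|) *
     (W * ((m%:R + 1) * B ^+ 2) + (W * B ^+ 2 + e) * T%:R))).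
    rewrite ler_wpM2l ?expR_ge0// lerD// ler_wpM2l//.
    by rewrite addr_ge0 ?(ltW e0)// mulr_ge0// sqr_ge0.
  by rewrite ler_wpM2r// ler_expR ler_wpM2l.
have Ed : e * (expR (2 * T%:R) * (T%:R + 1)) = d by rewrite /e mulfVK// gt_eqF.
have : 0 <= e * expR (2 * T%:R) by rewrite mulr_ge0 ?expR_ge0// ltW.
by rewrite -Ed; lra.
Unshelve. all: by end_near. Qed.

End WaveEstimate.

(** * From energy to pointwise bounds on all derivatives *)

Section SupEstimate.
Context {R : realType} {m : nat} (tau : 'I_m).
Implicit Types (v w : 'rV[R]_m -> R) (x y : 'rV[R]_m) (i : 'I_m) (l : seq 'I_m).
Local Notation space := (space tau).
Local Notation wave_op := (wave_op tau).

Lemma sup_bound (T : nat) : exists M k C, [/\ (1 <= C), (T <= M)%N &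
  forall v (B : R), smooth v -> 0 <= B ->
  (forall l y, (size l <= k)%N -> cube M y -> y 0 tau = 0 -> `|pderivs l v y| <= B) ->
  (forall l y, (size l <= k)%N -> cube M y -> `|pderivs l (wave_op v) y| <= B) ->
  forall x, cube T x -> `|v x| <= C * B].
Proof.
(* T may be 0, while [sobolev] needs a box of positive size. *)
have [M [C0 [C00 TM H]]] := @energy_bound R m tau T.+1.
pose K : R := 2 ^+ size space; have K0 : 0 <= K by rewrite exprn_ge0.
(* [sobolev] takes at most one derivative per spatial direction, and [energy_bound] one more at time
   0. One K comes from [sobolev], the other from [near_sobsum]; adding 1 avoids a square root, as D
   <= (D + 1)^2. *)
exists M, (size space).+1, (K * (K * C0) + 1); split.
- by rewrite lerDr !mulr_ge0.
- exact: ltnW.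
move=> v B sv B0 H0 H1 x Tx.
have Tx' : cube T.+1 x by move=> i; apply: le_trans (Tx i) _; rewrite ler_nat.
have key (d : R) : 0 < d -> v x ^+ 2 <= K * (K * (C0 * B ^+ 2 + d)) + d.
  move=> d0; near \oo => N.
  have S : v x ^+ 2 <= K * rsums T.+1 N space (sobsum space v) x + d.
    suff : forall x, cube T.+1 x -> (forall i, i \in space -> `|x 0 i| <= T.+1%:R) ->
       v x ^+ 2 <= K * rsums T.+1 N space (sobsum space v) x + d.
      by apply=> // i _; exact: Tx'.
    by near: N; exact: sobolev.
  apply: le_trans S _; rewrite lerD2r ler_wpM2l//.
  suff : forall x, cube T.+1 x ->
    rsums T.+1 N space (sobsum space v) x <= K * (C0 * B ^+ 2 + d) by exact.
  near: N; apply: near_sobsum => l ls; apply: H => //.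
  - exact: smooth_pderivs.
  - move=> y My yt; split; first by apply: H0 => //; exact: leqW.
    by move=> i; have := H0 (i :: l) y ls My yt.
  by move=> y My; rewrite -pderivs_wave_op//; apply: H1 => //; exact: leqW.
(* N has disappeared, so d can tend to 0. *)
have {}key : v x ^+ 2 <= K * (K * (C0 * B ^+ 2)).
  apply/ler_addgt0Pr => e e0.
  have K1 : 0 < K * K + 1 by rewrite ltr_wpDl// mulr_ge0.
  apply: le_trans (key (e / (K * K + 1)) _) _; first by rewrite divr_gt0.
  have E : e / (K * K + 1) * (K * K + 1) = e by rewrite mulfVK// gt_eqF.
  by rewrite -{3}E; lra.
set D := K * (K * C0); have D0 : 0 <= D by rewrite !mulr_ge0.
have CB : 0 <= (D + 1) * B by rewrite mulr_ge0// addr_ge0.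
rewrite -ler_sqr ?nnegrE//.
rewrite real_normK ?num_real//; apply: le_trans key _.
have -> : K * (K * (C0 * B ^+ 2)) = D * B ^+ 2 by rewrite /D; ring.
rewrite exprMn ler_wpM2r ?sqr_ge0//.
by have := sqr_ge0 D; lra.
Unshelve. all: by end_near. Qed.

(* Time derivatives at t = 0 are traded for spatial ones by means of
   d_t^2 w = Laplacian w + wave_op w. *)
Lemma initial_bound (k a : nat) w (B : R) l y : smooth w -> 0 <= B ->
  y 0 tau = 0 ->
  (forall l', (size l' <= k)%N -> tau \notin l' ->
    `|pderivs l' w y| <= B /\ `|pderivs l' (pderiv tau w) y| <= B) ->
  (forall l', (size l' <= k)%N -> `|pderivs l' (wave_op w) y| <= B) ->
  (size l + a <= k)%N -> tau \notin l ->
  `|pderivs l (pderivs (nseq a tau) w) y| <= m.+1%:R ^+ a * B.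
Proof.
(* Two base cases, because the equation replaces two time derivatives at once. *)
move=> sw B0 yt H0 H1; elim/ltn_ind: a l => -[|[|a]] IH l lk tl.
- by rewrite mul1r /=; have [] := H0 l (leq_trans (leq_addr _ _) lk) tl.
- have [_ h] := H0 l (leq_trans (leq_addr _ _) lk) tl.
  by apply: le_trans h _; rewrite expr1 ler_peMl// ler1n.
set u := pderivs (nseq a tau) w; have su : smooth u by exact: smooth_pderivs.
have s2 i j : smooth (pderiv i (pderiv j u)) by do 2 apply: smooth_pderiv.
have E : pderivs (nseq a.+2 tau) w =
    wave_op u + \sum_(i | i != tau) pderiv i (pderiv i u).
  by rewrite /wave_op subrK.
rewrite E pderivsD//; [|exact: smooth_wave_op|exact: smooth_sum].
rewrite pderivs_sum// -pderivs_wave_op// -pderivs_cat fctE fct_sumE.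
apply: le_trans (ler_normD _ _) _.
have h1 : `|pderivs (l ++ nseq a tau) (wave_op w) y| <= B.
  by apply: H1; rewrite size_cat size_nseq (leq_trans _ lk)// leq_add2l ltnW.
have h2 i : i != tau -> `|pderivs l (pderiv i (pderiv i u)) y| <= m.+1%:R ^+ a * B.
  move=> it; rewrite -!pderivs_rcons; apply: IH => //.
    by rewrite !size_rcons !addSn -!addnS.
  by do 2 rewrite mem_rcons in_cons negb_or eq_sym it /=.
have h3 : `|\sum_(i | i != tau) pderivs l (pderiv i (pderiv i u)) y| <=
    m%:R * (m.+1%:R ^+ a * B).
  apply: le_trans (ler_norm_sum _ _ _) _.
  apply: (@le_trans _ _ (\sum_(i < m) m.+1%:R ^+ a * B)); last first.
    by rewrite sumr_const card_ord mulr_natl.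
  rewrite [leRHS](bigID (fun i => i != tau))/= -[leLHS]addr0 lerD//.
    by apply: ler_sum => i /h2.
  by apply: sumr_ge0 => i _; rewrite mulr_ge0// exprn_ge0.
have p1 : 1 <= m.+1%:R ^+ a :> R by rewrite exprn_ege1// ler1n.
(* At most m second derivatives and one source term: a factor m + 1 for each replacement. *)
apply: (@le_trans _ _ (m.+1%:R ^+ a.+1 * B)).
  apply: le_trans (lerD h1 h3) _; rewrite exprS; set P := m.+1%:R ^+ a in p1 *.
  have PB : B <= P * B by rewrite ler_peMl.
  by rewrite -[m.+1%:R]natr1; lra.
by rewrite ler_wpM2r// ler_weXn2l ?ler1n.
Qed.

(** Derivatives commute with [wave_op], so [sup_bound] applies to each derivative of w;
    [initial_bound] reduces its initial data to spatial derivatives of w and d_t w. *)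
Lemma wave_estimate (T j : nat) : exists M k C, 0 <= C /\
  forall w (B : R), smooth w -> 0 <= B ->
  (forall l y, (size l <= k)%N -> tau \notin l -> cube M y -> y 0 tau = 0 ->
    `|pderivs l w y| <= B /\ `|pderivs l (pderiv tau w) y| <= B) ->
  (forall l y, (size l <= k)%N -> cube M y -> `|pderivs l (wave_op w) y| <= B) ->
  forall l x, (size l <= j)%N -> cube T x -> `|pderivs l w x| <= C * B.
Proof.
have [M [k [C [C1 TM H]]]] := sup_bound T.
exists M, (k + j)%N, (C * m.+1%:R ^+ (k + j)); split.
  by rewrite mulr_ge0 ?exprn_ge0// (le_trans _ C1).
move=> w B sw B0 H0 H1 l x lj Tx; rewrite -mulrA.
have mB : B <= m.+1%:R ^+ (k + j) * B by rewrite ler_peMl// exprn_ege1// ler1n.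
apply: H => //; first exact: smooth_pderivs.
- by rewrite mulr_ge0// exprn_ge0.
- move=> l' y l'k My yt; rewrite -pderivs_cat.
  set L := l' ++ l; have Lk : (size L <= k + j)%N by rewrite size_cat leq_add.
  (* Derivatives commute, so the time directions of L can be gathered next to w. *)
  pose s := [seq i <- L | i != tau]; pose a := count_mem tau L.
  have sa : (size s + a = size L)%N.
    by rewrite size_filter addnC count_predC.
  have -> : pderivs L w = pderivs s (pderivs (nseq a tau) w).
    rewrite -pderivs_cat; apply: pderivs_perm => //.
    have -> : nseq a tau = seq.filter (pred1 tau) L.
      have /all_pred1P -> : all (pred1 tau) (seq.filter (pred1 tau) L) by exact: filter_all.
      by rewrite size_filter.
    by rewrite perm_sym perm_catC perm_filterC.
  apply: le_trans (@initial_bound (k + j) a w B s y sw B0 yt _ _ _ _) _.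
  + by move=> l0 l0k tl0; exact: H0.
  + by move=> l0 l0k; exact: H1.
  + by rewrite sa.
  + by rewrite mem_filter eqxx.
  rewrite ler_wpM2r// ler_weXn2l ?ler1n//.
  by rewrite (leq_trans _ Lk)// -sa leq_addl.
move=> l' y l'k My; rewrite -pderivs_wave_op// -pderivs_cat.
by apply: le_trans mB; apply: H1 => //; rewrite size_cat leq_add.
Qed.

End SupEstimate.

(** * The estimate for nets of complex-valued functions *)

Section NetEstimates.
Context {R : realType}.

Definition net_O {m : nat} (K : set 'rV[R]_m) (j : nat) (u : net R m) (b : R) :=
  is_bigO (fun e => sup_deriv K [set alpha | (mdegree alpha <= j)%N] (u e)) b.

Lemma cmderiv_Re_le {m : nat} (K : set 'rV[R]_m) j (f : 'rV[R]_m -> R[i]) (B : R) :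
  csmooth f ->
  (forall alpha x, (mdegree alpha <= j)%N -> K x ->
    Normc.normc (cmderiv alpha f x) <= B) ->
  forall l x, (size l <= j)%N -> K x ->
    `|pderivs l (Repart f) x| <= B /\ `|pderivs l (Impart f) x| <= B.
Proof.
move=> [sr si] H l x lj Kx; split.
  have [alpha da ->] := pderivs_mderiv l sr.
  have := H alpha x; rewrite da => /(_ lj Kx); apply: le_trans.
  by rewrite /= -sqrtr_sqr ler_sqrt ?addr_ge0 ?sqr_ge0// lerDl sqr_ge0.
have [alpha da ->] := pderivs_mderiv l si.
have := H alpha x; rewrite da => /(_ lj Kx); apply: le_trans.
by rewrite /= -sqrtr_sqr ler_sqrt ?addr_ge0 ?sqr_ge0// lerDr sqr_ge0.
Qed.

Lemma cmderiv_le {m : nat} (K : set 'rV[R]_m) j (f : 'rV[R]_m -> R[i]) (B : R) :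
  (forall l x, (size l <= j)%N -> K x ->
    `|pderivs l (Repart f) x| <= B /\ `|pderivs l (Impart f) x| <= B) ->
  forall alpha x, (mdegree alpha <= j)%N -> K x ->
    Normc.normc (cmderiv alpha f x) <= 2 * B.
Proof.
move=> H alpha x aj Kx; rewrite /cmderiv /cmap /=.
have [l sl ->] := mderiv_pderivs alpha (Repart f).
have [l' sl' ->] := mderiv_pderivs alpha (Impart f).
have lj : (size l <= j)%N by rewrite sl.
have lj' : (size l' <= j)%N by rewrite sl'.
have [h1 _] := H l x lj Kx; have [_ h2] := H l' x lj' Kx.
have B0 : 0 <= B := le_trans (normr_ge0 _) h1.
have sq (a : R) : `|a| <= B -> a ^+ 2 <= B ^+ 2.
  by move=> aB; rewrite -[leLHS]real_normK ?num_real// lerXn2r ?nnegrE.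
rewrite -[leRHS]ger0_norm ?mulr_ge0// -sqrtr_sqr ler_sqrt ?sqr_ge0//.
rewrite exprMn; have := sq _ h1; have := sq _ h2; have := sqr_ge0 B; lra.
Qed.

Lemma compact_sub_cube {m : nat} (K : set 'rV[R]_m) :
  compact K -> exists T, K `<=` cube T.
Proof.
move=> /compact_bounded[r [_ rK]]; pose s := `|r| + 1.
have rs : r < s by rewrite (le_lt_trans (ler_norm r))// ltrDl.
exists (Num.bound s) => x Kx i.
have xs : `|x| <= s by exact: rK.
apply: le_trans (_ : `|x| <= _).
  rewrite [leRHS]mx_normrE.
  exact: (le_bigmax _ (fun p : 'I_1 * 'I_m => `|x p.1 p.2|) (0, i)).
by apply: le_trans xs _; rewrite ltW// archi_boundP// addr_ge0.
Qed.

Section Space.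
Context {n : nat}.
Let tau : 'I_(n + 1) := rshift n ord0.

Lemma rshift_time (i : 'I_1) : rshift n i = tau.
Proof. by rewrite ord1. Qed.

Lemma lshift_space (i : 'I_n) : (lshift 1 i != tau).
Proof. by apply/eqP => /(congr1 val) /= E; have := ltn_ord i; rewrite E addn0 ltnn. Qed.

Lemma pderivs_embed0 l (g : 'rV[R]_(n + 1) -> R) :
  pderivs l (g \o embed0) = pderivs (map (lshift 1) l) g \o embed0.
Proof. by elim: l => //= i l ->; rewrite pderiv_embed0. Qed.

Lemma spatial_seq (l : seq 'I_(n + 1)) :
  tau \notin l -> exists l', l = map (lshift 1) l'.
Proof.
elim: l => [|i l IH]; first by exists [::].
rewrite inE negb_or => /andP[it /IH[l' ->]].
case: (split_ordP i) it => k -> it; first by exists (k :: l').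
by rewrite rshift_time eqxx in it.
Qed.

Lemma embed0_cube M (y : 'rV[R]_(n + 1)) : cube M y -> y 0 tau = 0 ->
  exists2 x : 'rV[R]_n, cube M x & y = embed0 x.
Proof.
move=> My y0; exists (lsubmx y) => [i|].
  by rewrite mxE; exact: My.
rewrite -[LHS]hsubmxK /embed0; congr row_mx; apply/rowP => i.
by rewrite !mxE rshift_time.
Qed.

(** The source computed from a representative: with it the equation holds exactly, for every
    epsilon. *)
Definition EM_wave (u : EM R (n + 1)) : EM R (n + 1) :=
  EM_pderiv tau (EM_pderiv tau u) -
  \sum_(i < n) EM_pderiv (lshift 1 i) (EM_pderiv (lshift 1 i) u).

Lemma RepartD (V : Type) (f g : V -> R[i]) : Repart (f + g) = Repart f + Repart g.
Proof. by apply/funext => x; rewrite /Repart !fctE; case: (f x) (g x) => [a b] []. Qed.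

Lemma ImpartD (V : Type) (f g : V -> R[i]) : Impart (f + g) = Impart f + Impart g.
Proof. by apply/funext => x; rewrite /Impart !fctE; case: (f x) (g x) => [a b] []. Qed.

Lemma wave_op_lshift (v : 'rV[R]_(n + 1) -> R) : wave_op tau v =
  pderiv tau (pderiv tau v) -
  \sum_(i < n) pderiv (lshift 1 i) (pderiv (lshift 1 i) v).
Proof.
rewrite /wave_op; congr (_ - _); rewrite big_split_ord/=.
rewrite [X in _ + X]big1 ?addr0 => [|i]; last by rewrite rshift_time eqxx.
by apply: eq_bigl => i; rewrite lshift_space.
Qed.

Lemma Repart_EM_wave (u : EM R (n + 1)) e :
  Repart (EM_val (EM_wave u) e) = wave_op tau (Repart (EM_val u e)).
Proof.
rewrite wave_op_lshift /EM_wave.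
rewrite -[EM_val _ e]/(EM_val (EM_pderiv tau (EM_pderiv tau u)) e -
  EM_val (\sum_(i < n) EM_pderiv (lshift 1 i) (EM_pderiv (lshift 1 i) u)) e).
rewrite RepartB; congr (_ - _).
rewrite (big_morph (fun u => Repart (EM_val u e)) (id1 := 0) (op1 := +%R))//.
by move=> v w; exact: RepartD.
Qed.

Lemma Impart_EM_wave (u : EM R (n + 1)) e :
  Impart (EM_val (EM_wave u) e) = wave_op tau (Impart (EM_val u e)).
Proof.
rewrite wave_op_lshift /EM_wave.
rewrite -[EM_val _ e]/(EM_val (EM_pderiv tau (EM_pderiv tau u)) e -
  EM_val (\sum_(i < n) EM_pderiv (lshift 1 i) (EM_pderiv (lshift 1 i) u)) e).
rewrite ImpartB; congr (_ - _).
rewrite (big_morph (fun u => Impart (EM_val u e)) (id1 := 0) (op1 := +%R))//.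
by move=> v w; exact: ImpartD.
Qed.

(** The order b survives because the constant of [wave_estimate] is the same for every epsilon. *)
Lemma net_wave_estimate (K : set 'rV[R]_(n + 1)) j : compact K ->
  exists M k, forall (u : EM R (n + 1)) b,
    net_O (cube M) k (EM_val (EM_restr0 u)) b ->
    net_O (cube M) k (EM_val (EM_restr0 (EM_pderiv tau u))) b ->
    net_O (cube M) k (EM_val (EM_wave u)) b ->
    net_O K j (EM_val u) b.
Proof.
move=> /compact_sub_cube[T KT].
have [M [k [C [C0 H]]]] := @wave_estimate R (n + 1) tau T j.
exists M, k => u b /is_bigO_sup_derivP[C1 [e1 [C10 e10 H1]]].
move=> /is_bigO_sup_derivP[C2 [e2 [C20 e20 H2]]].
move=> /is_bigO_sup_derivP[C3 [e3 [C30 e30 H3]]].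
apply/is_bigO_sup_derivP; exists (2 * (C * (C1 + C2 + C3))).
exists (Num.min e1 (Num.min e2 e3)); split.
- by rewrite mulr_ge0// mulr_ge0// !addr_ge0.
- by rewrite !lt_min e10 e20.
move=> e; rewrite !lt_min => /and3P[{}/H1 H1 {}/H2 H2 {}/H3 H3].
have [sr si] := (EM_moderate u).1 e; have p0 : 0 <= sval e `^ b := powR_ge0 _ _.
set B := (C1 + C2 + C3) * sval e `^ b.
have B0 : 0 <= B by rewrite mulr_ge0// !addr_ge0.
have B1 : C1 * sval e `^ b <= B by rewrite ler_wpM2r// -addrA lerDl addr_ge0.
have B2 : C2 * sval e `^ b <= B by rewrite ler_wpM2r// addrAC lerDr addr_ge0.
have B3 : C3 * sval e `^ b <= B by rewrite ler_wpM2r// lerDr addr_ge0.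
have {}H1 := cmderiv_Re_le ((EM_moderate (EM_restr0 u)).1 e) H1.
have {}H2 := cmderiv_Re_le ((EM_moderate (EM_restr0 (EM_pderiv tau u))).1 e) H2.
have {}H3 := cmderiv_Re_le ((EM_moderate (EM_wave u)).1 e) H3.
move=> alpha x aj Kx; rewrite -[2 * _ * _]mulrA -[C * _ * _]mulrA -/B.
apply: (@cmderiv_le _ K j) => // l {}x lj {}Kx; split.
  apply: H (KT _ Kx) => //.
    (* Spatial derivatives at t = 0 are derivatives of the restriction to t = 0. *)
    move=> l' y l'k /spatial_seq[l0 E] My yt.
    have [z Mz ->] := embed0_cube My yt; rewrite E size_map in l'k *.
    rewrite -![pderivs _ _ (embed0 z)]/((pderivs (map (lshift 1) l0) _ \o embed0) z).
    rewrite -!pderivs_embed0; split.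
      by have [h _] := H1 l0 z l'k Mz; exact: le_trans h B1.
    by have [h _] := H2 l0 z l'k Mz; exact: le_trans h B2.
  move=> l' y l'k My; rewrite -Repart_EM_wave.
  by have [h _] := H3 l' y l'k My; exact: le_trans h B3.
apply: H (KT _ Kx) => //.
  move=> l' y l'k /spatial_seq[l0 E] My yt.
  have [z Mz ->] := embed0_cube My yt; rewrite E size_map in l'k *.
  rewrite -![pderivs _ _ (embed0 z)]/((pderivs (map (lshift 1) l0) _ \o embed0) z).
  rewrite -!pderivs_embed0; split.
    by have [_ h] := H1 l0 z l'k Mz; exact: le_trans h B1.
  by have [_ h] := H2 l0 z l'k Mz; exact: le_trans h B2.
move=> l' y l'k My; rewrite -Impart_EM_wave.
by have [_ h] := H3 l' y l'k My; exact: le_trans h B3.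
Qed.

End Space.

End NetEstimates.

(** * Ultrametric properties of the sharp topology *)

Section SharpTopologyFacts.
Context {R : realType} {m : nat}.
Implicit Types (u v : colombeau R m) (K : set 'rV[R]_m) (j : nat).

Lemma pi_colombeauD (u v : EM R m) : \pi_(colombeau R m)%qT (u + v) =
  \pi_(colombeau R m)%qT u + \pi_(colombeau R m)%qT v.
Proof. exact: Quotient.pi_add. Qed.

Lemma pi_colombeauB (u v : EM R m) : \pi_(colombeau R m)%qT (u - v) =
  \pi_(colombeau R m)%qT u - \pi_(colombeau R m)%qT v.
Proof. by rewrite pi_colombeauD; congr (_ + _); exact: Quotient.pi_opp. Qed.

(** The strict inequality says that the supremum exceeds - ln r, so some admissible exponent already
    does. *)
Lemma pseudo_seminorm_lt K j (u : EM R m) (r : R) : compact K -> 0 < r ->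
  (pseudo_seminorm K j (\pi_(colombeau R m)%qT u) < r%:E)%E <->
  exists2 b, - ln r < b & net_O K j (EM_val u) b.
Proof.
move=> cK r0; rewrite /pseudo_seminorm valuation_pi//.
rewrite -{1}(lnK r0) -[(expR (ln r))%:E]/(expeR (ln r)%:E) lte_expeR.
rewrite lteNl -EFinN; split=> [/ereal_sup_gt[_ [b bO <-]]|[b rb bO]].
  by rewrite lte_fin => rb; exists b.
apply: (@lt_le_trans _ _ b%:E); first by rewrite lte_fin.
by apply: ereal_sup_ubound; exists b.
Qed.

Lemma net_OB K j (u v : EM R m) (b b' : R) :
  net_O K j (EM_val u) b -> net_O K j (EM_val v) b' ->
  net_O K j (EM_val (u - v)) (Num.min b b').
Proof.
move=> uO vO; have [su _] := EM_moderate u; have [sv _] := EM_moderate v.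
apply: is_bigOB => //.
  by apply: is_bigO_le uO; rewrite ge_min lexx.
by apply: is_bigO_le vO; rewrite ge_min lexx orbT.
Qed.

(** The radius does not double: the order of a difference is at least the smaller of the two
    orders. *)
Lemma pseudo_seminormB_lt K j u v (r : R) : compact K -> 0 < r ->
  (pseudo_seminorm K j u < r%:E)%E -> (pseudo_seminorm K j v < r%:E)%E ->
  (pseudo_seminorm K j (u - v)%R < r%:E)%E.
Proof.
move=> cK r0; rewrite -(reprK u) -(reprK v) -pi_colombeauB.
move=> /(pseudo_seminorm_lt _ _ cK r0)[b rb bO].
move=> /(pseudo_seminorm_lt _ _ cK r0)[b' rb' bO'].
apply/pseudo_seminorm_lt => //; exists (Num.min b b'); last exact: net_OB.
by rewrite lt_min rb.
Qed.

Lemma pseudo_seminorm0_lt K j (r : R) : compact K -> 0 < r ->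
  (pseudo_seminorm K j (0%R : colombeau R m) < r%:E)%E.
Proof.
move=> cK r0; rewrite -(subrr (\pi_(colombeau R m)%qT 0)) -pi_colombeauB subr0.
apply/pseudo_seminorm_lt => //; exists (- ln r + 1); first by rewrite ltrDl.
exact: is_bigO0.
Qed.

Lemma nbhs_seminorm_ball K j u (r : R) : compact K -> 0 < r ->
  nbhs u (seminorm_ball K j u r).
Proof.
move=> cK r0; rewrite nbhsE; exists (seminorm_ball K j u r) => //; split.
  exists [set seminorm_ball K j u r]; last by rewrite bigcup_set1.
  move=> _ ->; exists [fset (K, j, u, r)]%fset.
    by move=> p; rewrite inE => /eqP ->; exact: mem_set.
  by rewrite set_fset1 bigcap_set1.
by rewrite /seminorm_ball /= subrr; exact: pseudo_seminorm0_lt.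
Qed.

(** The subbase has balls with arbitrary centres; by the ultrametric inequality a ball containing
    [g x] contains the ball of the same radius about [g x]. *)
Lemma continuous_seminorm_ball (X : topologicalType) (g : X -> colombeau R m) x :
  (forall K j r, compact K -> 0 < r ->
    \forall y \near x, seminorm_ball K j (g x) r (g y)) ->
  {for x, continuous g}.
Proof.
move=> H A; rewrite nbhsE => -[B [[D sD <-] [C DC Cgx]] BA].
have [E sE CE] := sD _ DC.
apply: (@filterS _ _ _ (g @^-1` C)) => [y Cy|]; first by apply: BA; exists C.
rewrite -CE in Cgx *.
apply: (@filterS _ _ _ (\bigcap_(i in [set` E])
   g @^-1` (seminorm_ball i.1.1.1 i.1.1.2 i.1.2 i.2))).
  by move=> y Hy i iE; exact: Hy.
apply: filter_bigI => -[[[K j] v] r] iE.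
have [/= cK r0] := set_mem (sE _ iE).
have gv := Cgx _ iE; rewrite /seminorm_ball /= in gv.
have := H K j r cK r0; apply: filterS => y; rewrite /seminorm_ball /= => yx.
have -> : g y - v = g y - g x - (0 - (g x - v)) by rewrite sub0r opprK subrKA.
apply: (pseudo_seminormB_lt cK r0 yx).
exact: (pseudo_seminormB_lt cK r0 (pseudo_seminorm0_lt _ cK r0) gv).
Qed.

End SharpTopologyFacts.

(** * Linearity of the Cauchy problem, and continuity *)

Section LinearOperators.
Context {R : realType}.

Lemma gpderivB {m : nat} (i : 'I_m) (u v : colombeau R m) :
  gpderiv i (u - v) = gpderiv i u - gpderiv i v.
Proof.
rewrite -(reprK u) -(reprK v) -pi_colombeauB !gpderiv_pi -pi_colombeauB.
congr (\pi_(colombeau R m)%qT _); apply: val_inj; apply/funext => e /=.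
have [su _] := EM_moderate (repr u); have [sv _] := EM_moderate (repr v).
exact: cpderivB.
Qed.

Lemma grestr0B {n : nat} (u v : colombeau R (n + 1)) :
  grestr0 (u - v) = grestr0 u - grestr0 v.
Proof.
rewrite -(reprK u) -(reprK v) -pi_colombeauB !grestr0_pi -pi_colombeauB.
by congr (\pi_(colombeau R n)%qT _); apply: val_inj.
Qed.

Context {n : nat}.
Implicit Types (c d : colombeau R n) (f u : colombeau R (n + 1)).

Lemma wave_cauchyB c d f u c' d' f' u' :
  wave_cauchy c d f u -> wave_cauchy c' d' f' u' ->
  wave_cauchy (c - c') (d - d') (f - f') (u - u').
Proof.
move=> [<- <- <-] [<- <- <-]; split; [|exact: grestr0B|].
  rewrite /dt !gpderivB /laplacian /dx.
  under eq_bigr do rewrite !gpderivB.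
  have alg (a b a' b' : colombeau R (n + 1)) :
      a - a' - (b - b') = a - b - (a' - b').
    by rewrite !opprB addrACA [RHS]addrACA [- a' - b]addrC.
  by rewrite sumrB alg.
by rewrite -grestr0B /dt gpderivB.
Qed.

(** The data are represented by what U produces; the negligible discrepancy with other
    representatives is absorbed by the classes, and so by the seminorms. *)
Lemma wave_cauchy_pi c d f (U : EM R (n + 1)) :
  wave_cauchy c d f (\pi_(colombeau R (n + 1))%qT U) ->
  [/\ c = \pi_(colombeau R n)%qT (EM_restr0 U),
      d = \pi_(colombeau R n)%qT (EM_restr0 (EM_pderiv (rshift n ord0) U)) &
      f = \pi_(colombeau R (n + 1))%qT (EM_wave U)].
Proof.
move=> [<- <- <-]; split; first exact: grestr0_pi.
  by rewrite /dt gpderiv_pi grestr0_pi.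
rewrite /EM_wave pi_colombeauB /dt !gpderiv_pi; congr (_ - _).
rewrite (big_morph (\pi_(colombeau R (n + 1))%qT) (id1 := 0) (op1 := +%R)).
- by apply: eq_bigr => i _; rewrite /dx !gpderiv_pi.
- exact: pi_colombeauD.
by apply: (addIr (\pi_(colombeau R (n + 1))%qT 0)); rewrite -pi_colombeauD !add0r.
Qed.

Lemma wave_seminorm_estimate (K : set 'rV[R]_(n + 1)) j : compact K ->
  exists M k, forall c d f u (r : R), 0 < r -> wave_cauchy c d f u ->
    (pseudo_seminorm (cube M) k c < r%:E)%E ->
    (pseudo_seminorm (cube M) k d < r%:E)%E ->
    (pseudo_seminorm (cube M) k f < r%:E)%E ->
    (pseudo_seminorm K j u < r%:E)%E.
Proof.
move=> cK; have [M [k H]] := net_wave_estimate j cK; exists M, k.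
move=> c d f u r r0; rewrite -(reprK u) => /wave_cauchy_pi[-> -> ->].
move=> /(pseudo_seminorm_lt _ _ (@compact_cube _ _ _) r0)[b1 rb1 bO1].
move=> /(pseudo_seminorm_lt _ _ (@compact_cube _ _ _) r0)[b2 rb2 bO2].
move=> /(pseudo_seminorm_lt _ _ (@compact_cube _ _ _) r0)[b3 rb3 bO3].
apply/pseudo_seminorm_lt => //; exists (Num.min b1 (Num.min b2 b3)).
  by rewrite !lt_min rb1 rb2.
apply: H.
- by apply: is_bigO_le bO1; rewrite ge_min lexx.
- by apply: is_bigO_le bO2; rewrite !ge_min lexx orbT.
- by apply: is_bigO_le bO3; rewrite !ge_min lexx !orbT.
Qed.

End LinearOperators.

Theorem mainTheorem18 (R : realType) (n : nat) (n_gt0 : (0 < n)%N)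
    (sol : colombeau R n -> colombeau R n -> colombeau R (n + 1) ->
           colombeau R (n + 1))
    (solP : forall c d f, wave_cauchy c d f (sol c d f)) :
  continuous (fun p : colombeau R n * colombeau R n * colombeau R (n + 1) =>
    sol p.1.1 p.1.2 p.2).
Proof.
move=> [[c0 d0] f0]; apply: continuous_seminorm_ball => K j r cK r0.
have [M [k H]] := @wave_seminorm_estimate R n K j cK.
have cM m : compact (@cube R m M) by exact: compact_cube.
exists ((seminorm_ball (cube M) k c0 r `*` seminorm_ball (cube M) k d0 r),
  seminorm_ball (cube M) k f0 r) => /=.
  split; last exact: nbhs_seminorm_ball.
  exists (seminorm_ball (cube M) k c0 r, seminorm_ball (cube M) k d0 r) => //=.
  by split; exact: nbhs_seminorm_ball.
move=> [[c d] f] [[/= cc dd] ff].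
(* The difference of two solutions solves the problem for the difference of the data. *)
by apply: (H _ _ _ _ r r0 (wave_cauchyB (solP c d f) (solP c0 d0 f0))).
Qed.
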